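(* Let $P\in\mathbb{C}\{x,y\}$ with $P(0,y)\not\equiv0$, having no zeros in $U\cap(\mathbb{R}\times\mathbb{H})$ for a neighborhood $U$ of the origin and no factors in common with $\bar P$, and write $P=u\prod_{j=1}^M(y+q_j(x)+x^{2L_j}\psi_j(x^{1/k}))$ as in the context. Let $K=\max\{2L_1,\dots,2L_M\}$. If $Q\in\mathbb{C}\{x,y\}$ and $Q/P\in L^{\infty}_{loc}$, then $$\frac{\partial}{\partial y}\frac{Q}{P}\in L^{\mathfrak{p}}_{loc}\quad\text{for all }1\le\mathfrak{p}<1+1/K.$$
   Context: $\mathbb{H}=\{\operatorname{Im}z>0\}$, $\bar P(x,y)=\overline{P(\bar x,\bar y)}$. Such $P$ factors locally as $P=u\prod_{j=1}^M(y+q_j(x)+x^{2L_j}\psi_j(x^{1/k}))$, $M=\mathrm{Ord}(P(0,y))$, with $u$ a unit in $\mathbb{C}\{x,y\}$, $k\ge1$, $L_j\in\mathbb{N}$, $q_j\in\mathbb{R}[x]$, $q_j(0)=0$, $\deg q_j<2L_j$, $\psi_j\in\mathbb{C}\{x\}$, $\operatorname{Im}\psi_j(0)>0$. $f\in L^{\mathfrak{p}}_{loc}$ means $f\in L^{\mathfrak{p}}(U')$ (Lebesgue measure) for some neighborhood $U'$ of $(0,0)$ in $\mathbb{R}^2$, $1\le\mathfrak{p}\le\infty$. *)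

(* Defs.v *)
From HB Require Import structures.
From mathcomp Require Import all_boot all_order all_algebra.
From mathcomp Require Import all_classical all_reals all_analysis.
From mathcomp.real_closed Require Export complex.
Set Implicit Arguments. Unset Strict Implicit. Unset Printing Implicit Defensive.
Import Order.TTheory GRing.Theory Num.Theory.
Local Open Scope ring_scope.
Local Open Scope classical_set_scope.

Definition cabs (R : rcfType) (z : R[i]) : R := Normc.normc z.

Section Defs.
Variable R : realType.
Local Notation C := R[i].

Definition ps2_conv (c : nat -> nat -> C) (x y v : C) : Prop :=
  forall e : R, 0 < e -> exists N : nat, forall n : nat, (N <= n)%N ->
    cabs ((\sum_(i < n) \sum_(j < n) c i j * x ^+ i * y ^+ j) - v) < e.

Definition ps1_conv (c : nat -> C) (x v : C) : Prop :=
  forall e : R, 0 < e -> exists N : nat, forall n : nat, (N <= n)%N ->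
    cabs ((\sum_(i < n) c i * x ^+ i) - v) < e.

(** [f] is (near 0) given by a convergent power series in C{x,y}:
    coefficients with a positive radius r (Cauchy bound) and f equals
    the sum of the series on the bidisc of radius r. *)
Definition analytic2_at0 (f : C -> C -> C) : Prop :=
  exists (c : nat -> nat -> C) (r B : R), 0 < r /\
    (forall i j, cabs (c i j) * r ^+ (i + j) <= B) /\
    (forall x y, cabs x < r -> cabs y < r -> ps2_conv c x y (f x y)).

Definition analytic1_at0 (g : C -> C) : Prop :=
  exists (c : nat -> C) (r B : R), 0 < r /\
    (forall i, cabs (c i) * r ^+ i <= B) /\
    (forall x, cabs x < r -> ps1_conv c x (g x)).

Definition gdvd2 (D F : C -> C -> C) : Prop :=
  exists G, analytic2_at0 G /\ exists r : R, 0 < r /\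
    forall x y, cabs x < r -> cabs y < r -> F x y = D x y * G x y.

(** [P] and [Q] have no factor in common in C{x,y}: every common divisor is a
    unit (the non-units of C{x,y} are exactly the germs vanishing at 0). *)
Definition no_common_factor (P Q : C -> C -> C) : Prop :=
  ~ exists D, [/\ analytic2_at0 D, D 0 0 = 0, gdvd2 D P & gdvd2 D Q].

Definition pbar (P : C -> C -> C) : C -> C -> C :=
  fun x y => conjc (P (conjc x) (conjc y)).

Definition ord0y (P : C -> C -> C) (M : nat) : Prop :=
  exists g, [/\ analytic1_at0 g, g 0 != 0 &
    exists r : R, 0 < r /\ forall y, cabs y < r -> P 0 y = y ^+ M * g y].

Definition leb2 := (@lebesgue_measure R \x @lebesgue_measure R)%E.

Definition sq (r : R) : set (R * R) := `]-r, r[ `*` `]-r, r[.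

Definition cmeasurable (D : set (R * R)) (f : R * R -> C) : Prop :=
  measurable_fun D (fun z => complex.Re (f z)) /\
  measurable_fun D (fun z => complex.Im (f z)).

Definition Lp_loc (p : R) (f : R * R -> C) : Prop :=
  exists r : R, 0 < r /\ cmeasurable (sq r) f /\
    (\int[leb2]_(z in sq r) ((cabs (f z)) `^ p)%:E < +oo)%E.

Definition Linfty_loc (f : R * R -> C) : Prop :=
  exists r : R, 0 < r /\ cmeasurable (sq r) f /\
    exists B : R, {ae leb2, forall z, sq r z -> cabs (f z) <= B}.

End Defs.

(* Main.v *)
Require Import Defs.
From HB Require Import structures.
From mathcomp Require Import all_boot all_order all_algebra.
From mathcomp Require Import all_classical all_reals all_analysis.
From mathcomp Require Import measurable_realfun ring lra.
From mathcomp.real_closed Require Import complex.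
Set Implicit Arguments. Unset Strict Implicit. Unset Printing Implicit Defensive.
Import Order.TTheory GRing.Theory Num.Theory.
Import numFieldNormedType.Exports.
Local Open Scope ring_scope.
Local Open Scope classical_set_scope.

(** For real (x, y) with x <> 0 let F_j be the j-th linear factor of P and let d
    be at most every |F_j(x, y)|.  For |t - y| <= d each |F_j(x, t)| is at most
    2 |F_j(x, y)|, so |P(x, t)| and, since Q / P is bounded, |Q(x, t)| are
    O(|P(x, y)|); moreover d^M = O(|P(x, y)|).  On [y, y + d] the functions
    P(x, .) and Q(x, .) agree up to O(d^M) with Taylor polynomials of fixed
    degree, so the Markov inequality gives |d/dy P|, |d/dy Q| = O(|P| / d) at
    (x, y), hence |d/dy (Q / P)| = O(1 / d).  Because Im psi_j(0) > 0, |F_j| is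
    comparable from below to m_j = |y + q_j(x)| + |x|^(2 L_j), and
    m_j^(-p) <= |y + q_j(x)|^(-a) |x|^(-2 L_j (p - a)), where a < 1 can be taken
    so close to 1 that 2 L_j (p - a) < 1; Tonelli's theorem then concludes. *)

(** * Double power series on the real plane *)

(** The derivative estimate has to stay on the real line. Cauchy's formula on a disc of radius d
    would serve for P, but [Q / P] is bounded at real points only, which gives no control of Q by P
    at complex t; a Markov inequality on a real interval asks for nothing more. Such an inequality
    concerns polynomials of a fixed degree, hence the Taylor truncation, and its error is harmless
    exactly because a product of M factors of modulus at least d dominates d^M. Real and imaginary
    parts are handled as real power series, so that the mean value theorem is available. On the line
    x = 0 the factors may vanish and no estimate is made; the line is negligible, and the final
    majorant is infinite on it. *)

Section RealSeries.
Context {R : realType}.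
Implicit Types (c : nat -> nat -> R) (f : R -> R -> R) (x y h r B : R).

Definition ps2 c n x y : R := \sum_(i < n) \sum_(j < n) c i j * x ^+ i * y ^+ j.

Definition real_analytic2 r f := exists c B, [/\ 0 < r,
  forall i j, `|c i j| * r ^+ (i + j) <= B &
  forall x y, `|x| < r -> `|y| < r -> ps2 c n x y @[n --> \oo] --> f x y].

Lemma sum_half_le n : \sum_(i < n) (2^-1 : R) ^+ i <= 2.
Proof.
have := @geometric_le_lim R n 1 2^-1 ler01.
rewrite /series /= big_mkord => h.
have E : 1 / (1 - 2^-1) = 2 :> R by field.
rewrite -[leRHS]E; apply: le_trans (h _ _); [|by lra|by rewrite ger0_norm; lra].
by apply: ler_sum => i _; rewrite mul1r.
Qed.

Lemma sum_geom_le n B (a : nat -> R) : 0 <= B ->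
  (forall i, `|a i| <= B * 2^-1 ^+ i) -> `|\sum_(i < n) a i| <= B * 2.
Proof.
move=> B0 ha; apply: le_trans (ler_norm_sum _ _ _) _.
apply: le_trans (_ : B * \sum_(i < n) 2^-1 ^+ i <= _).
  by rewrite mulr_sumr; apply: ler_sum.
by rewrite ler_wpM2l// sum_half_le.
Qed.

Lemma sum2_geom_le n B (a : nat -> nat -> R) : 0 <= B ->
  (forall i j, `|a i j| <= B * 2^-1 ^+ i * 2^-1 ^+ j) ->
  `|\sum_(i < n) \sum_(j < n) a i j| <= B * 4.
Proof.
move=> B0 ha.
have -> : B * 4 = B * 2 * 2 by ring.
apply: (@sum_geom_le n _ (fun i => \sum_(j < n) a i j)); first by lra.
move=> i; rewrite mulrAC; apply: sum_geom_le; last by move=> j; exact: ha.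
by rewrite mulr_ge0// exprn_ge0.
Qed.

Lemma coef_bound_ge0 c r B : 0 < r ->
  (forall i j, `|c i j| * r ^+ (i + j) <= B) -> 0 <= B.
Proof.
move=> r0 /(_ 0%N 0%N); apply: le_trans.
by rewrite mulr_ge0// exprn_ge0// ltW.
Qed.

(** Shrinking the bidisc by [k] turns the Cauchy bound into geometric decay. The value 1/2 makes the
    terms summable; 1/8 leaves room for the factor j^2 of a second-order expansion. *)
Lemma term_bound c r B (k : R) x y i j : 0 < r -> 0 < k ->
  (forall i j, `|c i j| * r ^+ (i + j) <= B) ->
  `|x| <= r * k -> `|y| <= r * k ->
  `|c i j * x ^+ i * y ^+ j| <= B * k ^+ i * k ^+ j.
Proof.
move=> r0 k0 hc hx hy.
rewrite !normrM !normrX.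
apply: le_trans (_ : `|c i j| * r ^+ (i + j) * (k ^+ i * k ^+ j) <= _); last first.
  by rewrite -[leRHS]mulrA ler_wpM2r// mulr_ge0// exprn_ge0// ltW.
rewrite exprD.
have -> : `|c i j| * (r ^+ i * r ^+ j) * (k ^+ i * k ^+ j) =
  `|c i j| * (r * k) ^+ i * (r * k) ^+ j by rewrite !exprMn; ring.
apply: ler_pM; rewrite ?mulr_ge0 ?exprn_ge0//; last first.
  by apply: lerXn2r => //; rewrite ?nnegrE// mulr_ge0 ?ltW.
rewrite ler_wpM2l//.
by apply: lerXn2r => //; rewrite ?nnegrE// mulr_ge0 ?ltW.
Qed.

Lemma ps2_bound c r B n x y : 0 < r ->
  (forall i j, `|c i j| * r ^+ (i + j) <= B) ->
  `|x| <= r / 2 -> `|y| <= r / 2 -> `|ps2 c n x y| <= B * 4.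
Proof.
move=> r0 hc hx hy; apply: (@sum2_geom_le n B (fun i j => c i j * x ^+ i * y ^+ j)).
  exact: coef_bound_ge0 hc.
by move=> i j; apply: (@term_bound c r).
Qed.

Lemma ps2S c n x y : ps2 c n.+1 x y = ps2 c n x y +
  (\sum_(i < n) c i n * x ^+ i * y ^+ n +
   \sum_(j < n.+1) c n j * x ^+ n * y ^+ j).
Proof.
rewrite /ps2 big_ord_recr/= addrA -big_split/=; congr (_ + _).
by apply: eq_bigr => i _; rewrite big_ord_recr.
Qed.

Lemma cvg_of_geom_increments (u : R^nat) B :
  (forall n, `|u n.+1 - u n| <= B * 2^-1 ^+ n) -> cvgn u.
Proof.
move=> hu.
have B0 : 0 <= B by have := hu 0%N; rewrite expr0 mulr1; apply: le_trans.
have sc : cvgn (series (telescope u)).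
  apply: normed_cvg; apply: (@series_le_cvg _ _ (geometric B 2^-1)) => //.
  - by move=> n /=.
  - by move=> n; rewrite /geometric/= mulr_ge0// exprn_ge0.
  - by apply: is_cvg_geometric_series; rewrite ger0_norm; lra.
have -> : u = (fun n => u 0%N + series (telescope u) n).
  by apply/funext => n; rewrite -eq_sum_telescope.
by apply: is_cvgD => //; exact: is_cvg_cst.
Qed.

Lemma ps2_cvg c r B x y : 0 < r ->
  (forall i j, `|c i j| * r ^+ (i + j) <= B) ->
  `|x| <= r / 2 -> `|y| <= r / 2 -> cvgn (fun n => ps2 c n x y).
Proof.
move=> r0 hc hx hy; apply: (@cvg_of_geom_increments _ (B * 4)) => n.
have B0 := coef_bound_ge0 r0 hc.
have tb i j : `|c i j * x ^+ i * y ^+ j| <= B * 2^-1 ^+ i * 2^-1 ^+ j.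
  exact: (@term_bound c r).
rewrite ps2S addrC addKr.
have -> : B * 4 * 2^-1 ^+ n = B * 2^-1 ^+ n * 2 + B * 2^-1 ^+ n * 2 by ring.
apply: le_trans (ler_normD _ _) _.
have Bn0 : 0 <= B * 2^-1 ^+ n by rewrite mulr_ge0// exprn_ge0.
apply: lerD.
  apply: (@sum_geom_le n _ (fun i => c i n * x ^+ i * y ^+ n)) => // i.
  by rewrite (mulrAC B); exact: tb.
by apply: (@sum_geom_le n.+1 _ (fun j => c n j * x ^+ n * y ^+ j)).
Qed.

Definition dcoef c i j : R := j.+1%:R * c i j.+1.

(** Halving the radius absorbs the factor j + 1 <= 2^j; the division by [r] pays for the shift of
    the index. *)
Lemma dcoef_bound c r B : 0 < r ->
  (forall i j, `|c i j| * r ^+ (i + j) <= B) ->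
  forall i j, `|dcoef c i j| * (r / 2) ^+ (i + j) <= B / r.
Proof.
move=> r0 hc i j.
rewrite ler_pdivlMr// /dcoef normrM normr_nat.
apply: le_trans (hc i j.+1).
rewrite addnS exprSr exprMn.
have -> : j.+1%:R * `|c i j.+1| * (r ^+ (i + j) * 2^-1 ^+ (i + j)) * r =
  (j.+1%:R * 2^-1 ^+ (i + j)) * (`|c i j.+1| * (r ^+ (i + j) * r)) by ring.
rewrite ler_piMl//; first by rewrite mulr_ge0// mulr_ge0 ?exprn_ge0// ltW.
rewrite exprVn ler_pdivrMr ?exprn_gt0// mul1r -natrX ler_nat.
by rewrite (leq_trans (ltn_expl j (ltnSn 1)))// leq_exp2l// leq_addl.
Qed.

Definition dps2 c n x y : R :=
  \sum_(i < n) \sum_(j < n) c i j * x ^+ i * (j%:R * y ^+ j.-1).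

(** Differentiation in y drops a column, so the square of size n + 1 becomes the square of size n of
    [dcoef c] together with its row of index n. That extra row tends to 0 geometrically. *)
Lemma dps2S c n x y : dps2 c n.+1 x y = ps2 (dcoef c) n x y +
  x ^+ n * \sum_(j < n) dcoef c n j * y ^+ j.
Proof.
rewrite /dps2 big_ord_recr/=; congr (_ + _).
  apply: eq_bigr => i _; rewrite big_ord_recl/= mul0r mulr0 add0r.
  by apply: eq_bigr => j _; rewrite /dcoef /bump/= add1n; ring.
rewrite big_ord_recl/= mul0r mulr0 add0r mulr_sumr.
by apply: eq_bigr => j _; rewrite /dcoef /bump/= add1n; ring.
Qed.

Lemma dps2_cvg c r B x y (l : R) : 0 < r ->
  (forall i j, `|c i j| * r ^+ (i + j) <= B) ->
  `|x| <= r / 4 -> `|y| <= r / 4 ->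
  ps2 (dcoef c) n x y @[n --> \oo] --> l ->
  (dps2 c n x y @[n --> \oo] --> l).
Proof.
move=> r0 hc hx hy hl; rewrite -cvg_shiftS.
under eq_fun do rewrite /= dps2S.
rewrite -[l]addr0; apply: cvgD => //.
have r2 : 0 < r / 2 by lra.
have hd := dcoef_bound r0 hc.
have Br0 := coef_bound_ge0 r2 hd.
apply/norm_cvg0P.
apply: (@squeeze_cvgr _ _ _ _ (fun=> 0) (geometric (B / r * 2) 2^-1)).
- near=> n; rewrite normr_ge0/= /geometric/= mulr_sumr mulrAC.
  have Bn0 : 0 <= B / r * 2^-1 ^+ n by rewrite mulr_ge0// exprn_ge0.
  apply: (@sum_geom_le n _ (fun j => x ^+ n * (dcoef c n j * y ^+ j))) => // j.
  rewrite mulrCA mulrA; apply: (@term_bound _ (r / 2)) => //; lra.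
- exact: cvg_cst.
- by apply: cvg_geometric; rewrite ger0_norm; lra.
Unshelve. all: by end_near.
Qed.

(** The factor rho^2 on the left avoids the exponent j - 2. The remainder satisfies e_(j+1) = (y +
    h) e_j + j h^2 y^(j-1), and j^2 + j <= (j + 1)^2 closes the induction. *)
Lemma expr_second_order (rho y h : R) j : `|y| <= rho -> `|y + h| <= rho ->
  `|(y + h) ^+ j - y ^+ j - h * (j%:R * y ^+ j.-1)| * rho ^+ 2
  <= j%:R ^+ 2 * rho ^+ j * h ^+ 2.
Proof.
move=> hy hyh; have rho0 : 0 <= rho := le_trans (normr_ge0 _) hy.
elim: j => [|j IH].
  by rewrite !expr0 subrr mul0r mulr0 subr0 normr0 !mul0r expr0n/= !mul0r.
have -> : (y + h) ^+ j.+1 - y ^+ j.+1 - h * (j.+1%:R * y ^+ j.+1.-1) =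
   (y + h) * ((y + h) ^+ j - y ^+ j - h * (j%:R * y ^+ j.-1))
   + j%:R * h ^+ 2 * y ^+ j.-1.
  case: j {IH} => [|j]; first by rewrite !expr0 !expr1 /=; ring.
  by rewrite /= !exprS -!natr1; ring.
set e := (_ - _ - _) in IH *.
apply: le_trans (_ : (rho * `|e| + j%:R * h ^+ 2 * rho ^+ j.-1) * rho ^+ 2 <= _).
  rewrite ler_wpM2r ?exprn_ge0//; apply: le_trans (ler_normD _ _) _.
  rewrite lerD//; first by rewrite normrM ler_wpM2r.
  rewrite [`|_ * y ^+ _|]normrM [`|_ * h ^+ 2|]ger0_norm; last by rewrite mulr_ge0 ?sqr_ge0.
  rewrite ler_wpM2l//; first by rewrite mulr_ge0 ?sqr_ge0.
  by rewrite normrX; apply: lerXn2r => //; rewrite nnegrE.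
have E : j%:R * rho ^+ j.-1 * rho = j%:R * rho ^+ j.
  by case: j {IH e} => [|j]; rewrite ?mul0r// -mulrA -exprSr.
have -> : (rho * `|e| + j%:R * h ^+ 2 * rho ^+ j.-1) * rho ^+ 2 =
  rho * (`|e| * rho ^+ 2) + (j%:R * rho ^+ j.-1 * rho) * rho * h ^+ 2 by ring.
rewrite E.
apply: le_trans (lerD (ler_wpM2l rho0 IH) (lexx _)) _.
rewrite -subr_ge0.
have -> : j.+1%:R ^+ 2 * rho ^+ j.+1 * h ^+ 2 -
  (rho * (j%:R ^+ 2 * rho ^+ j * h ^+ 2) + j%:R * rho ^+ j * rho * h ^+ 2)
  = (j%:R + 1) * rho ^+ j.+1 * h ^+ 2 by rewrite !exprS -!natr1; ring.
by apply: mulr_ge0 (sqr_ge0 _); apply: mulr_ge0; rewrite ?exprn_ge0.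
Qed.

(** The bound does not depend on [n], so it passes to the limit and yields the derivative of the sum
    directly, without an argument on uniform convergence of the derivatives. *)
Lemma ps2_second_order c r B n x y h : 0 < r ->
  (forall i j, `|c i j| * r ^+ (i + j) <= B) ->
  `|x| <= r / 8 -> `|y| <= r / 8 -> `|y + h| <= r / 8 ->
  `|ps2 c n x (y + h) - ps2 c n x y - h * dps2 c n x y| <=
    B * h ^+ 2 / (r / 8) ^+ 2 * 4.
Proof.
move=> r0 hc hx hy hyh.
have B0 := coef_bound_ge0 r0 hc.
set rho := r / 8; have rho0 : 0 < rho by rewrite /rho; lra.
rewrite /ps2 /dps2 mulr_sumr -!sumrB.
under eq_bigr => i _ do rewrite mulr_sumr -!sumrB.
pose e j := (y + h) ^+ j - y ^+ j - h * (j%:R * y ^+ j.-1).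
rewrite (_ : \sum_i _ = \sum_(i < n) \sum_(j < n) c i j * x ^+ i * e j); last first.
  by apply: eq_bigr => i _; apply: eq_bigr => j _; rewrite /e; ring.
apply: (@sum2_geom_le n _ (fun i j => c i j * x ^+ i * e j)).
  by rewrite mulr_ge0 ?invr_ge0 ?sqr_ge0// mulr_ge0 ?sqr_ge0.
move=> i j.
have -> : B * h ^+ 2 / rho ^+ 2 * 2^-1 ^+ i * 2^-1 ^+ j =
  (B * 2^-1 ^+ i * 2^-1 ^+ j) * h ^+ 2 / rho ^+ 2 by ring.
rewrite ler_pdivlMr ?exprn_gt0// normrM -[leLHS]mulrA.
apply: le_trans (ler_wpM2l (normr_ge0 _) (expr_second_order j hy hyh)) _.
rewrite mulrA ler_wpM2r ?sqr_ge0//.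
have tb : `|c i j * x ^+ i| * rho ^+ j <= B * 8^-1 ^+ i * 8^-1 ^+ j.
  have -> : `|c i j * x ^+ i| * rho ^+ j = `|c i j * x ^+ i * rho ^+ j|.
    by rewrite [RHS]normrM; congr (_ * _); rewrite ger0_norm ?exprn_ge0// ltW.
  by apply: (@term_bound c r) => //; rewrite ger0_norm// ltW.
rewrite mulrCA; apply: le_trans (ler_wpM2l _ tb) _; first exact: sqr_ge0.
have -> : j%:R ^+ 2 * (B * 8^-1 ^+ i * 8^-1 ^+ j) =
  B * 8^-1 ^+ i * (j%:R ^+ 2 * 8^-1 ^+ j) by ring.
apply: ler_pM; rewrite ?mulr_ge0 ?exprn_ge0 ?sqr_ge0//.
  by rewrite ler_wpM2l//; apply: lerXn2r; rewrite ?nnegrE; lra.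
(* Since j^2 <= 4^j, the decay 8^-j is still 2^-j after the loss of j^2. *)
have -> : 2^-1 ^+ j = (2 ^+ 2) ^+ j * 8^-1 ^+ j :> R.
  by rewrite -exprMn; congr (_ ^+ _); field.
rewrite ler_wpM2r ?exprn_ge0// exprAC.
apply: lerXn2r; rewrite ?nnegrE ?exprn_ge0//.
by rewrite -natrX ler_nat ltnW// ltn_expl.
Qed.

Lemma is_derive_quadratic (f : R -> R) y l C d : 0 < d -> 0 <= C ->
  (forall h, `|h| < d -> `|f (y + h) - f y - h * l| <= C * h ^+ 2) ->
  is_derive y 1 f l.
Proof.
move=> d0 C0 hf.
have cv : h^-1 *: ((f \o shift y) (h *: 1) - f y) @[h --> 0^'] --> l.
  apply/cvgrPdist_le => /= e e0; near=> h.
  have h0 : h != 0 by near: h; exact: nbhs_dnbhs_neq.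
  have hd : `|h| < d by near: h; apply: dnbhs0_lt.
  have hC : `|h| <= e / (C + 1).
    by near: h; apply: dnbhs0_le; rewrite divr_gt0// ltr_wpDl.
  rewrite /= /GRing.scale/= mulr1 (addrC h y) -normrN opprB.
  have -> : h^-1 * (f (y + h) - f y) - l = h^-1 * (f (y + h) - f y - h * l).
    by field.
  rewrite normrM normfV ler_pdivrMl ?normr_gt0//.
  apply: le_trans (hf h hd) _.
  rewrite -real_normK ?num_real// expr2 mulrCA ler_wpM2l//.
  apply: le_trans (ler_wpM2l C0 hC) _.
  rewrite mulrA ler_pdivrMr; last by lra.
  nra.
apply: DeriveDef; first by apply/cvg_ex; exists l.
exact/cvg_lim.
Unshelve. all: by end_near.
Qed.

Lemma real_analytic2_shrink r r' f : 0 < r' -> r' <= r ->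
  real_analytic2 r f -> real_analytic2 r' f.
Proof.
move=> r'0 r'r [c [B [r0 hc hf]]]; exists c, B; split => // [i j|x y hx hy].
  apply: le_trans (hc i j); rewrite ler_wpM2l//.
  by apply: lerXn2r => //; rewrite nnegrE ltW.
by apply: hf; apply: lt_le_trans r'r.
Qed.

Lemma cvg_norm_le (u : R^nat) (l C : R) :
  u @ \oo --> l -> (forall n, `|u n| <= C) -> `|l| <= C.
Proof.
move=> /cvg_norm ul uC; apply: (cvgr_to_le ul).
by near=> n; exact: uC.
Unshelve. all: by end_near.
Qed.

Lemma real_analytic2_bounded r f : real_analytic2 r f ->
  exists2 C, 0 <= C & forall x y, `|x| < r / 2 -> `|y| < r / 2 -> `|f x y| <= C.
Proof.
move=> [c [B [r0 hc hf]]]; exists (B * 4).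
  by rewrite mulr_ge0//; exact: coef_bound_ge0 hc.
move=> x y hx hy; have xr : `|x| < r by lra. have yr : `|y| < r by lra.
apply: (cvg_norm_le (hf _ _ xr yr)) => n.
by apply: (@ps2_bound c r) => //; exact: ltW.
Qed.

Lemma real_analytic2_derive r f : real_analytic2 r f ->
  exists2 f', real_analytic2 (r / 8) f' &
    forall x y, `|x| < r / 8 -> `|y| < r / 8 -> is_derive y 1 (f x) (f' x y).
Proof.
move=> [c [B [r0 hc hf]]].
have r2 : 0 < r / 2 by lra.
have hd := dcoef_bound r0 hc.
pose f' x y := limn (fun n => ps2 (dcoef c) n x y).
have hf' x y : `|x| < r / 8 -> `|y| < r / 8 ->
    ps2 (dcoef c) n x y @[n --> \oo] --> f' x y.
  by move=> hx hy; apply: (ps2_cvg r2 hd); lra.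
exists f'.
  exists (dcoef c), (B / r); split => // [|i j]; first by lra.
  apply: le_trans (hd i j); rewrite ler_wpM2l//.
  by apply: lerXn2r; rewrite ?nnegrE; lra.
move=> x y hx hy.
apply: (@is_derive_quadratic _ _ _ (B / (r / 8) ^+ 2 * 4) (r / 8 - `|y|)).
- by lra.
- rewrite !mulr_ge0 ?invr_ge0 ?exprn_ge0//; first exact: coef_bound_ge0 hc.
  by lra.
- move=> h hh.
  have yh : `|y + h| < r / 8 by apply: le_lt_trans (ler_normD _ _) _; lra.
  have -> : B / (r / 8) ^+ 2 * 4 * h ^+ 2 = B * h ^+ 2 / (r / 8) ^+ 2 * 4 by ring.
  apply: (@cvg_norm_le
    (fun n => ps2 c n x (y + h) - ps2 c n x y - h * dps2 c n x y)).
    apply: cvgB; first by apply: cvgB; apply: hf; lra.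
    apply: cvgM; first exact: cvg_cst.
    by apply: (dps2_cvg r0 hc); [lra..|exact: hf'].
  by move=> n; apply: ps2_second_order => //; exact: ltW.
Qed.

Lemma real_analytic2_transpose r f : real_analytic2 r f ->
  real_analytic2 r (fun x y => f y x).
Proof.
move=> [c [B [r0 hc hf]]]; exists (fun i j => c j i), B; split => // [i j|x y hx hy].
  by rewrite addnC.
suff -> : (fun n => ps2 (fun i j => c j i) n x y) = (fun n => ps2 c n y x).
  exact: hf.
apply/funext => n; rewrite /ps2 exchange_big.
by apply: eq_bigr => i _; apply: eq_bigr => j _; ring.
Qed.

(** * Lipschitz bounds and measurability of analytic functions *)

Lemma mean_value_le (g dg : R -> R) (C a b : R) :
  (forall t : R, (a <= t <= b) || (b <= t <= a) ->
     is_derive t (1 : R) g (dg t) /\ `|dg t| <= C) ->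
  `|g b - g a| <= C * `|b - a|.
Proof.
wlog ab : a b / a <= b => [wl hg|hg].
  have [ab|/ltW ba] := leP a b; first exact: wl.
  by rewrite distrC (distrC b); apply: wl => // t; rewrite orbC; exact: hg.
have its t : t \in `[a, b]%R -> (a <= t <= b) || (b <= t <= a).
  by rewrite in_itv/= => ->.
have [t tab||c cab ->] := @MVT_segment R g dg a b ab.
- by apply: (hg t (its _ _)).1; apply: subset_itv_oo_cc.
- apply: derivable_within_continuous => u uab.
  by have [[]] := hg u (its _ uab).
- by rewrite normrM ler_wpM2r// (hg c (its _ cab)).2.
Qed.

Lemma between (a b t s : R) : `|a| < s -> `|b| < s ->
  (a <= t <= b) || (b <= t <= a) -> `|t| < s.
Proof.
rewrite !ltr_norml => /andP[? ?] /andP[? ?] /orP[]/andP[? ?]; apply/andP; lra.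
Qed.

(** The path from (x, y) to (x', y') passes through the corner (x', y), and each leg uses one
    partial derivative. These exist for radius r / 8 and are bounded on half of it, whence r /
    16. *)
Lemma real_analytic2_lipschitz r f : real_analytic2 r f ->
  exists2 C, 0 <= C & forall x y x' y', `|x| < r / 16 -> `|y| < r / 16 ->
    `|x'| < r / 16 -> `|y'| < r / 16 ->
    `|f x' y' - f x y| <= C * (`|x' - x| + `|y' - y|).
Proof.
move=> hf; have r0 : 0 < r by case: hf => c [B []].
have [f1 af1 d1] := real_analytic2_derive hf.
have [f2 af2 d2] := real_analytic2_derive (real_analytic2_transpose hf).
have [C1 C10 b1] := real_analytic2_bounded af1.
have [C2 C20 b2] := real_analytic2_bounded af2.
have r16 : r / 8 / 2 = r / 16 by field.
rewrite r16 in b1 b2.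
exists (C1 + C2); first by rewrite addr_ge0.
move=> x y x' y' hx hy hx' hy'.
have -> : f x' y' - f x y = (f x' y' - f x' y) + (f x' y - f x y) by ring.
apply: le_trans (ler_normD _ _) _.
have h1 : `|f x' y' - f x' y| <= C1 * `|y' - y|.
  apply: (@mean_value_le _ (f1 x')) => t ht.
  have htr : `|t| < r / 16 by apply: between ht.
  by split; [apply: d1; lra|exact: b1].
have h2 : `|f x' y - f x y| <= C2 * `|x' - x|.
  apply: (@mean_value_le (fun t => f t y) (f2 y)) => t ht.
  have htr : `|t| < r / 16 by apply: between ht.
  by split; [apply: d2; lra|exact: b2].
have := normr_ge0 (x' - x); have := normr_ge0 (y' - y); nra.
Qed.

Lemma measurable_ps2 (D : set (R * R)) c n :
  measurable_fun D (fun z => ps2 c n z.1 z.2).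
Proof.
rewrite /ps2; apply: measurable_sum => i; apply: measurable_sum => j.
apply: measurable_funM; first apply: measurable_funM.
- exact: measurable_cst.
- by apply: measurable_funX; apply: measurable_funTS; exact: measurable_fst.
- by apply: measurable_funX; apply: measurable_funTS; exact: measurable_snd.
Qed.

Lemma real_analytic2_measurable r f : real_analytic2 r f ->
  measurable_fun (sq r) (fun z => f z.1 z.2).
Proof.
move=> [c [B [r0 hc hf]]].
apply: (@measurable_fun_cvg _ _ _ _ (fun n z => ps2 c n z.1 z.2)).
  by move=> n; exact: measurable_ps2.
move=> [x y] [/=]; rewrite !in_itv/= -!ltr_norml => hx hy; exact: hf.
Qed.

(** * Taylor expansion and a Markov inequality on short intervals *)

Lemma taylor_bound N (F : nat -> R -> R) (s C : R) : 0 <= C ->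
  (forall m t, (m < N)%N -> `|t| < s -> is_derive t (1 : R) (F m) (F m.+1 t)) ->
  (forall t, `|t| < s -> `|F N t| <= C) ->
  forall y h, `|y| < s -> `|y + h| < s ->
  `|F 0%N (y + h) - \sum_(m < N) F m y / m`!%:R * h ^+ m| <= C * `|h| ^+ N.
Proof.
move=> C0; elim: N F => [|N IH] F hd hC y h hy hyh.
  by rewrite big_ord0 subr0 expr0 mulr1 hC.
have {}IH := IH (fun m => F m.+1) (fun m t mN => hd m.+1 t mN) hC y.
(* [q] is the Taylor polynomial of [F 0] at y as a function of t. Its derivative is the Taylor
   polynomial of [F 1] of one order less, so the induction hypothesis bounds the derivative of
   [F 0 - q], and the mean value theorem supplies the last factor |h|. *)
pose p := \poly_(m < N.+1) (F m y / m`!%:R).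
pose q := p \Po ('X - y%:P).
have dpE : deriv p = \poly_(m < N) (F m.+1 y / m`!%:R).
  apply/polyP => m; rewrite coef_deriv !coef_poly ltnS; case: ifP => // _.
    rewrite -mulr_natr factS natrM; field.
    by rewrite pnatr_eq0 -lt0n fact_gt0 nat1r pnatr_eq0.
  by rewrite mul0rn.
have dqE t : (deriv q).[t] = \sum_(m < N) F m.+1 y / m`!%:R * (t - y) ^+ m.
  by rewrite deriv_comp dpE derivXsubC mulr1 horner_comp !hornerE horner_poly.
have qE t : q.[t] = \sum_(m < N.+1) F m y / m`!%:R * (t - y) ^+ m.
  by rewrite horner_comp !hornerE horner_poly.
pose phi t := F 0%N t - q.[t].
have phiy : phi y = 0.
  rewrite /phi qE subrr big_ord_recl/= expr0 fact0 mulr1 divr1 big1 ?addr0 ?subrr//.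
  by move=> i _; rewrite expr0n/= mulr0.
have phih : phi (y + h) = F 0%N (y + h) - \sum_(m < N.+1) F m y / m`!%:R * h ^+ m.
  by rewrite /phi qE addrAC subrr add0r.
rewrite -phih -[phi _]subr0 -phiy exprSr mulrA.
have -> : C * `|h| ^+ N * `|h| = C * `|h| ^+ N * `|y + h - y| by rewrite addrAC subrr add0r.
apply: (@mean_value_le phi (fun t => F 1%N t - (deriv q).[t])) => t ht.
have hts := between hy hyh ht.
split; first by apply: is_deriveB; exact: hd.
have := IH (t - y) hy; rewrite addrCA subrr addr0 dqE => /(_ hts) /le_trans; apply.
rewrite ler_wpM2l//; apply: lerXn2r; rewrite ?nnegrE//.
case/orP: ht => /andP[? ?]; first by rewrite !ger0_norm; lra.
by rewrite !ler0_norm; lra.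
Qed.

(** Numerical differentiation: the nodes j / (N + 2) are distinct, so the Vandermonde matrix is
    invertible, and the coefficient of degree 1 of a polynomial of degree at most N + 1 is a fixed
    combination of its values at the nodes. The weights are the inverse matrix applied to the basis
    vector of index 1. *)
Lemma vandermonde_weights N : exists w s : 'I_N.+2 -> R,
  (forall i, 0 <= s i <= 1) /\
  (forall m : 'I_N.+2, \sum_i w i * s i ^+ m = (m == 1%N :> nat)%:R).
Proof.
pose a : 'rV[R]_N.+2 := \row_j (j%:R / N.+2%:R).
have uV : Vandermonde N.+2 a \in unitmx.
  rewrite unitmxE unitfE det_Vandermonde.
  apply/prodf_neq0 => i _; apply/prodf_neq0 => j ij.
  rewrite !mxE -mulrBl mulf_neq0 ?invr_neq0 ?pnatr_eq0// subr_eq0 eqr_nat.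
  by rewrite gtn_eqF.
pose v := invmx (Vandermonde N.+2 a) *m delta_mx (Ordinal (isT : (1 < N.+2)%N)) (0 : 'I_1).
exists (fun i => v i 0), (fun i => a 0 i); split.
  move=> i; rewrite mxE divr_ge0//= ler_pdivrMr ?ltr0n// mul1r ler_nat.
  by rewrite ltnW.
move=> m; have := congr1 (fun A : 'cV_N.+2 => A m 0)
  (mulKVmx uV (delta_mx (Ordinal (isT : (1 < N.+2)%N)) (0 : 'I_1))).
rewrite -/v mxE => E.
transitivity (delta_mx (Ordinal (isT : (1 < N.+2)%N)) (0 : 'I_1) m 0 : R).
  by rewrite -E; apply: eq_bigr => i _; rewrite [Vandermonde _ _ _ _]mxE mulrC.
by rewrite mxE eqxx andbT.
Qed.

(** This is Markov's inequality at the left end of [0, d], with an unspecified constant. Rescaling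
    the nodes by [d] keeps [W] independent of [d]. *)
Lemma linear_coef_bound N : exists2 W : R, 0 <= W &
  forall (a : nat -> R) (d E : R),
  (forall s, 0 <= s <= 1 -> `|\sum_(m < N.+2) a m * (d * s) ^+ m| <= E) ->
  `|a 1%N * d| <= W * E.
Proof.
have [w [s [hs hw]]] := vandermonde_weights N.
exists (\sum_i `|w i|); first exact: sumr_ge0.
move=> a d E hE.
have -> : a 1%N * d = \sum_i w i * \sum_(m < N.+2) a m * (d * s i) ^+ m.
  under eq_bigr do rewrite mulr_sumr.
  rewrite exchange_big/=.
  transitivity (\sum_(m < N.+2) a m * d ^+ m * (m == 1%N :> nat)%:R).
    rewrite (bigD1 (Ordinal (isT : (1 < N.+2)%N)))//= expr1 mulr1 big1 ?addr0// => i /negbTE i1.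
    by rewrite (_ : (i == 1%N :> nat) = false) ?mulr0.
  apply: eq_bigr => m _; rewrite -hw mulr_sumr; apply: eq_bigr => i _.
  by rewrite exprMn; ring.
apply: le_trans (ler_norm_sum _ _ _) _; rewrite mulr_suml.
by apply: ler_sum => i _; rewrite normrM ler_wpM2l// hE.
Qed.

Lemma real_analytic2_taylor N r f : real_analytic2 r f ->
  exists (F : nat -> R -> R -> R) (s C : R), [/\ 0 < s, s <= r, 0 <= C, F 0%N = f &
   (forall m x y, (m < N)%N -> `|x| < s -> `|y| < s ->
      is_derive y (1 : R) (F m x) (F m.+1 x y)) /\
   (forall x y, `|x| < s -> `|y| < s -> `|F N x y| <= C)].
Proof.
elim: N r f => [|N IH] r f hf; have r0 : 0 < r by case: hf => c [B []].
  have [C C0 hC] := real_analytic2_bounded hf.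
  by exists (fun=> f), (r / 2), C; split => //; lra.
have [f' af' df'] := real_analytic2_derive hf.
have [F [s [C [s0 sr C0 F0 [dF bF]]]]] := IH _ _ af'.
exists (fun m => if m is m'.+1 then F m' else f), s, C; split => //; first by lra.
split=> // -[|m] x y mN hx hy /=; last exact: dF.
by rewrite F0; apply: df'; lra.
Qed.

Lemma real_analytic2_markov N r f : real_analytic2 r f ->
  exists (f' : R -> R -> R) (s W : R), [/\ 0 < s, s <= r, 0 <= W, real_analytic2 s f' &
   (forall x y, `|x| < s -> `|y| < s -> is_derive y (1 : R) (f x) (f' x y)) /\
   (forall x y d E, `|x| < s -> `|y| < s / 2 -> 0 <= d <= s / 2 ->
     (forall t, y <= t <= y + d -> `|f x t| <= E) ->
     `|f' x y| * d <= W * (E + d ^+ N.+2))].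
Proof.
move=> hf; have r0 : 0 < r by case: hf => c [B []].
have [f' af' df'] := real_analytic2_derive hf.
have [F [s [C [s0 sr C0 F0 [dF bF]]]]] := real_analytic2_taylor N.+1 af'.
have [V V0 hV] := linear_coef_bound N.
(* The Taylor polynomial of f is bounded by E + C d^(N+2), which is at most (C + 1)(E + d^(N+2)). *)
exists f', s, (V * (C + 1)); split => //.
- by lra.
- by rewrite mulr_ge0// addr_ge0.
- by apply: real_analytic2_shrink af'.
split=> [x y hx hy|x y d E hx hy /andP[d0 ds] hE]; first by apply: df'; lra.
have E0 : 0 <= E by apply: le_trans (hE y _); rewrite ?normr_ge0//; lra.
(* The chain [F] of derivatives starts at [f']; putting f in front gives N + 2 Taylor terms, whose
   coefficient of degree 1 is [f' x y], and a bounded derivative of order N + 2. *)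
pose G m := if m is m'.+1 then F m' x else f x.
have := hV (fun m => G m y / m`!%:R) d (E + C * d ^+ N.+2).
rewrite {2}/G F0 divr1 normrM [`|d|]ger0_norm// => /(_ _)/le_trans; apply.
  move=> t /andP[t0 t1].
  have dt0 : 0 <= d * t by rewrite mulr_ge0.
  have dtd : d * t <= d by rewrite ler_piMr.
  have hyt : `|y + d * t| < s.
    by move: hy; rewrite !ltr_norml => /andP[? ?]; apply/andP; lra.
  have ys : `|y| < s by lra.
  have dG m u : (m < N.+2)%N -> `|u| < s -> is_derive u (1 : R) (G m) (G m.+1 u).
    case: m => [|m] mN hu /=; last exact: dF.
    by rewrite F0; apply: df'; lra.
  have tb := taylor_bound C0 dG (fun u => bF x u hx) ys hyt.
  set S := \sum_(m < _) _ in tb *.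
  have -> : S = f x (y + d * t) - (f x (y + d * t) - S) by ring.
  apply: le_trans (ler_normB _ _) _; apply: lerD; first by apply: hE; lra.
  apply: le_trans tb _; rewrite ler_wpM2l//; apply: lerXn2r; rewrite ?nnegrE//.
  by rewrite ger0_norm.
rewrite -mulrA ler_wpM2l//.
have := exprn_ge0 N.+2 d0; nra.
Qed.

End RealSeries.

(** * A dyadic weight with an integrable singularity *)

Section DyadicWeight.
Context {R : realType}.
Implicit Types (g s t b r : R).

Definition dyadic_itv n : set R := `[- (2^-1 ^+ n), 2^-1 ^+ n].

(* A measurable majorant of |s|^(-g) near 0, infinite at 0. *)
Definition weight g s : \bar R :=
  (1 + \sum_(0 <= n <oo) ((2 ^+ n.+1) `^ g * \1_(dyadic_itv n) s)%:E)%E.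

Lemma weight_term_ge0 g n s : (0 <= ((2 ^+ n.+1) `^ g * \1_(dyadic_itv n) s)%:E)%E.
Proof. by rewrite lee_fin mulr_ge0 ?powR_ge0. Qed.

Lemma weight_ge1 g s : (1 <= weight g s)%E.
Proof. by rewrite /weight leeDl// nneseries_ge0// => n _ _; exact: weight_term_ge0. Qed.

Lemma weight_ge0 g s : (0 <= weight g s)%E.
Proof. exact: le_trans lee01 (weight_ge1 _ _). Qed.

(** Allowing t > |s| lets a sum such as |y + q(x)| + |x|^n stand for its first term. For t >= 1 the
    summand 1 is enough. Otherwise let n + 1 be the least exponent with 2^-(n+1) < t: then |s| <= t
    <= 2^-n, and the term of index n alone exceeds t^(-g). *)
Lemma weight_ge g s t : 0 <= g -> 0 < t -> `|s| <= t ->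
  ((t `^ (- g))%:E <= weight g s)%E.
Proof.
move=> g0 t0 st; rewrite powRN.
have [t1|t1] := leP 1 t.
  apply: le_trans (weight_ge1 _ _); rewrite lee_fin invf_le1 ?powR_gt0//.
  by rewrite -[leLHS](congr1 (@^~ g) (@powR1 R)) ge0_ler_powR// ?nnegrE// ltW.
have ex : exists n, 2^-1 ^+ n < t.
  have := @cvg_geometric R 1 2^-1; rewrite ger0_norm// => /(_ _)/cvgr_lt/(_ _ t0).
  case; first by lra.
  by move=> N _ /(_ N (leqnn _)); rewrite /= /geometric/= mul1r; exists N.
have [[|n] hn min] := ex_minnP ex; first by move: hn; rewrite expr0 ltNge (ltW t1).
have tn : t <= 2^-1 ^+ n.
  by rewrite leNgt; apply/negP => /min; rewrite ltnn.
have sn : dyadic_itv n s.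
  by rewrite /dyadic_itv/= in_itv/= -ler_norml (le_trans st).
rewrite /weight.
apply: le_trans (_ : ((2 ^+ n.+1) `^ g * \1_(dyadic_itv n) s)%:E <= _)%E.
  rewrite indicE mem_set// mulr1 lee_fin.
  have h2 : 0 < 2 ^+ n.+1 :> R by rewrite exprn_gt0.
  rewrite -div1r ler_pdivrMr ?powR_gt0// -powRM; [|exact: ltW..].
  rewrite -[leLHS](congr1 (@^~ g) (@powR1 R)) ge0_ler_powR// ?nnegrE//.
    by rewrite mulr_ge0// ltW.
  by rewrite -ler_pdivrMl// mulr1 -exprVn ltW.
rewrite -[leLHS]add0e leeD//.
rewrite (@nneseriesD1 R _ n xpredT)//.
by rewrite leeDl// nneseries_ge0// => m _ _; exact: weight_term_ge0.
Qed.

(** An integrable weight with the value +oo at 0 absorbs the line x = 0, where nothing is known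
    about the function to be integrated. *)
Lemma weight_half0 : weight 2^-1 0 = +oo%E.
Proof.
apply/eqyP => A A0.
have := @weight_ge 2^-1 0 (A `^ (-2)) _ _ _.
rewrite -powRrM mulrNN divff// powRr1; last exact: ltW.
apply; first by rewrite invr_ge0.
- exact: powR_gt0.
- by rewrite normr0 powR_ge0.
Qed.

Lemma measurable_weight g : measurable_fun setT (weight g).
Proof.
apply: emeasurable_funD; first exact: measurable_cst.
apply: ge0_emeasurable_sum => [n s _ _|n _]; first exact: weight_term_ge0.
apply/measurable_EFinP/measurable_funM; first exact: measurable_cst.
by apply: measurable_indic; exact: measurable_itv.
Qed.

Lemma measurable_weight_shift g b :
  measurable_fun setT (fun y : R => weight g (y + b)).
Proof.
apply: (measurableT_comp (measurable_weight g)).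
by apply: measurable_funD.
Qed.

Lemma dyadic_itv_shiftE n b : [set y | dyadic_itv n (y + b)] =
  `[- (2^-1 ^+ n) - b, 2^-1 ^+ n - b]%classic.
Proof.
by apply/seteqP; split => y; rewrite /dyadic_itv/= !in_itv/= => /andP[? ?]; apply/andP; lra.
Qed.

Lemma lebesgue_dyadic_shift n b :
  lebesgue_measure [set y | dyadic_itv n (y + b)] = (2 * 2^-1 ^+ n)%:E.
Proof.
rewrite dyadic_itv_shiftE lebesgue_measure_itv/= lte_fin.
have h0 : 0 < 2^-1 ^+ n :> R by rewrite exprn_gt0.
rewrite (_ : _ < _ = true); last by apply/idP; lra.
by rewrite -EFinB; congr (_%:E); ring.
Qed.

(** Uniformity in the shift [b] is the point, since Tonelli's theorem is applied with b = q(x). It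
    comes from measuring each translated dyadic interval as a whole. *)
Lemma weight_integral g r : 0 <= g -> g < 1 -> exists2 C : R, 0 <= C &
  forall b : R, (\int[lebesgue_measure]_(y in `](- r)%R, r[%classic) weight g (y + b) <= C%:E)%E.
Proof.
move=> g0 g1.
(* The term of index n takes the value 2^(g(n+1)) on an interval of length 2 * 2^-n, so it
   contributes at most [A * th ^+ n] with th = 2^(g-1) < 1. *)
pose th : R := (2 `^ (1 - g))^-1.
have th0 : 0 < th by rewrite invr_gt0 powR_gt0.
have th1 : `|th| < 1.
  rewrite ger0_norm 1?ltW// /th invf_lt1 ?powR_gt0//.
  rewrite -[ltLHS](congr1 (@^~ (1 - g)) (@powR1 R)).
  by rewrite gt0_ltr_powR ?nnegrE ?subr_gt0// ltr1n.
have thE : th = 2 `^ g / 2.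
  rewrite /th powRB ?powRr1//; last by apply/implyP.
  by rewrite invf_div.
pose A : R := 2 * 2 `^ g.
have A0 : 0 <= A by rewrite mulr_ge0 ?powR_ge0.
(* The first part is the integral of the summand 1, with |r| in case r is negative; the second is
   the sum of the geometric series. *)
exists (2 * `|r| + A / (1 - th)).
  rewrite addr_ge0 ?mulr_ge0 ?invr_ge0//; move: th1; rewrite ger0_norm; lra.
move=> b.
have mD : measurable (`](- r), r[%classic : set R) by exact: measurable_itv.
have mind n : measurable_fun (`](- r), r[%classic : set R)
    (fun y => \1_(dyadic_itv n) (y + b) : R).
  apply: measurable_funTS.
  apply: (@measurableT_comp _ _ _ _ _ _ (\1_(dyadic_itv n) : R -> R)).
    by apply: measurable_indic; exact: measurable_itv.
  by apply: measurable_funD.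
have msh n : measurable [set y | dyadic_itv n (y + b)].
  by rewrite dyadic_itv_shiftE; exact: measurable_itv.
have mterm n : measurable_fun (`](- r), r[%classic : set R)
    (fun y => ((2 ^+ n.+1) `^ g * \1_(dyadic_itv n) (y + b))%:E).
  by apply/measurable_EFinP/measurable_funM; [exact: measurable_cst|exact: mind].
rewrite ge0_integralD//; last 2 first.
- by move=> y _; rewrite nneseries_ge0// => n _ _; exact: weight_term_ge0.
- by apply: ge0_emeasurable_sum => [n s _ _|n _]; [exact: weight_term_ge0|exact: mterm].
rewrite EFinD leeD//.
  rewrite integral_cst// mul1e.
  apply: (@le_trans _ _ (lebesgue_measure (`](- r)%R, r[%classic : set R))) => //.
  rewrite lebesgue_measure_itv/= lte_fin.
  case: ifP => rr; last by rewrite lee_fin mulr_ge0.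
  by rewrite -EFinB lee_fin; have := ler_norm r; lra.
rewrite integral_nneseries//.
apply: lime_le.
  by apply: is_cvg_nneseries => n _ _; apply: integral_ge0 => y _; exact: weight_term_ge0.
near=> N.
apply: le_trans (_ : \sum_(0 <= n < N) (geometric A th n)%:E <= _)%E.
  apply: lee_sum => n _.
  under eq_integral do rewrite EFinM.
  rewrite ge0_integralZl_EFin ?powR_ge0//; last first.
    by apply/measurable_EFinP; exact: mind.
  rewrite (_ : (geometric A th n)%:E =
    ((2 ^+ n.+1) `^ g)%:E * (2 * 2^-1 ^+ n)%:E)%E; last first.
    have pE : (2 ^+ n.+1) `^ g = (2 `^ g) ^+ n.+1.
      by rewrite -powR_mulrn// -powRrM mulrC powRrM powR_mulrn ?powR_ge0.
    by rewrite -EFinM /geometric/= thE /A pE exprS exprMn; congr (_%:E); ring.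
  rewrite lee_wpmul2l ?lee_fin ?powR_ge0//.
  rewrite -(lebesgue_dyadic_shift n b).
  rewrite (_ : (fun y => _) = (fun y => (\1_[set y | dyadic_itv n (y + b)] y)%:E)); last first.
    by apply/funext => y; rewrite !indicE; congr ((_ : bool)%:R%:E); apply/idP/idP; rewrite !inE.
  rewrite integral_indic//; last exact: msh.
  apply: le_measure; rewrite ?inE//; last exact: msh.
  by apply: measurableI => //; exact: msh.
rewrite sumEFin lee_fin.
exact: geometric_le_lim.
Unshelve. all: by end_near.
Qed.

Lemma measurable_sq r : measurable (sq r : set (R * R)).
Proof. by apply: measurableX; exact: measurable_itv. Qed.

Lemma measurable_weight_poly g (q : {poly R}) :
  measurable_fun setT (fun z : R * R => weight g (z.2 + q.[z.1])).
Proof.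
apply: (measurableT_comp (measurable_weight g)).
apply: measurable_funD; first exact: measurable_snd.
apply: (@measurableT_comp _ _ _ _ _ _ (horner q)); first exact: measurable_poly.
exact: measurable_fst.
Qed.

Lemma measurable_weight2 a g (q : {poly R}) (D : set (R * R)) :
  measurable_fun D (fun z : R * R => weight a (z.2 + q.[z.1]) * weight g z.1)%E.
Proof.
apply: measurable_funTS; apply: emeasurable_funM; first exact: measurable_weight_poly.
by apply: (measurableT_comp (measurable_weight g)); exact: measurable_fst.
Qed.

Lemma weight2_ge0 a g (q : {poly R}) (z : R * R) :
  (0 <= weight a (z.2 + q.[z.1]) * weight g z.1)%E.
Proof. by rewrite mule_ge0 ?weight_ge0. Qed.

(** The inner integral in y is bounded independently of the shift q(x), which leaves a single weight
    in x. *)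
Lemma weight2_integral a g (q : {poly R}) r :
  0 <= a -> a < 1 -> 0 <= g -> g < 1 ->
  (\int[@leb2 R]_(z in sq r) (weight a (z.2 + q.[z.1]) * weight g z.1) < +oo)%E.
Proof.
move=> a0 a1 g0 g1.
have [C1 C10 hC1] := weight_integral r a0 a1.
have [C2 C20 hC2] := weight_integral r g0 g1.
pose f (z : R * R) := (weight a (z.2 + q.[z.1]) * weight g z.1)%E.
have f0 z : (0 <= f z)%E by exact: weight2_ge0.
have mI : measurable (`](- r), r[%classic : set R) by exact: measurable_itv.
have mf : measurable_fun setT (f \_ (sq r)).
  by apply/(measurable_restrictT _ (measurable_sq r)); exact: measurable_weight2.
have rf0 z : (0 <= (f \_ (sq r)) z)%E by apply: erestrict_ge0.
rewrite integral_mkcond /leb2 fubini_tonelli1//.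
apply: (@le_lt_trans _ _ (C1 * C2)%:E); last exact: ltry.
apply: (@le_trans _ _ (\int[@lebesgue_measure R]_x
   (C1%:E * ((weight g) \_ (`](- r)%R, r[%classic : set R)) x))%E).
  apply: ge0_le_integral => //.
  - by move=> x _; apply: integral_ge0.
  - exact: measurable_fun_fubini_tonelli_F.
  - apply: measurable_funeM; apply/(measurable_restrictT _ mI).
    by apply: measurable_funTS; exact: measurable_weight.
  move=> x _; rewrite /fubini_F.
  have [xr|xr] := pselect (`](- r), r[%classic x).
    rewrite [in leRHS]patchE mem_set//.
    rewrite (_ : (fun y => _) = (fun y => weight g x *
       ((fun y => weight a (y + q.[x])) \_ (`](- r)%R, r[%classic : set R)) y)%E); last first.
      apply/funext => y; rewrite !patchE.
      have [yr|yr] := pselect (`](- r), r[%classic y).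
        by rewrite !mem_set//= muleC.
      by rewrite !memNset ?mule0// => -[].
    rewrite ge0_integralZl//; last 3 first.
    - apply/(measurable_restrictT _ mI).
      by apply: measurable_funTS; exact: measurable_weight_shift.
    - by move=> y _; apply: erestrict_ge0 => *; exact: weight_ge0.
    - exact: weight_ge0.
    rewrite -integral_mkcond muleC lee_wpmul2r ?weight_ge0//.
  rewrite [in leRHS]patchE memNset// mule0 integral0_eq// => y _.
  by rewrite patchE memNset// => -[].
rewrite ge0_integralZl_EFin//; last 2 first.
- by move=> y _; apply: erestrict_ge0 => *; exact: weight_ge0.
- apply/(measurable_restrictT _ mI).
  by apply: measurable_funTS; exact: measurable_weight.
rewrite -integral_mkcond EFinM lee_wpmul2l ?lee_fin//.
apply: le_trans (hC2 0).
by under [leRHS]eq_integral do rewrite addr0.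
Qed.

End DyadicWeight.

(** * Complex absolute value and analytic germs *)

Section ComplexAbs.
Context {R : realType}.
Implicit Types (z w : R[i]) (x y : R).
Local Notation Re := complex.Re.
Local Notation Im := complex.Im.
Local Notation "x %:C" := (real_complex R x).

Lemma cabsE z : cabs z = Num.sqrt (Re z ^+ 2 + Im z ^+ 2).
Proof. by case: z. Qed.

Lemma cabs_ge0 z : 0 <= cabs z. Proof. by rewrite cabsE sqrtr_ge0. Qed.

Lemma cabs_sqr z : cabs z ^+ 2 = Re z ^+ 2 + Im z ^+ 2.
Proof. by rewrite cabsE sqr_sqrtr// addr_ge0 ?sqr_ge0. Qed.

Lemma cabs0 : cabs (0 : R[i]) = 0. Proof. exact: Normc.normc0. Qed.

Lemma cabs_eq0 z : (cabs z == 0) = (z == 0).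
Proof. by apply/eqP/eqP => [/Normc.eq0_normc|->]//; exact: cabs0. Qed.

Lemma cabs_gt0 z : (0 < cabs z) = (z != 0).
Proof. by rewrite lt_def cabs_ge0 andbT cabs_eq0. Qed.

Lemma cabsM z w : cabs (z * w) = cabs z * cabs w.
Proof. exact: Normc.normcM. Qed.

Lemma cabsV z : cabs z^-1 = (cabs z)^-1. Proof. exact: Normc.normcV. Qed.

Lemma cabsX z n : cabs (z ^+ n) = cabs z ^+ n.
Proof.
elim: n => [|n IH]; first by rewrite !expr0; exact: Normc.normc1.
by rewrite !exprS cabsM IH.
Qed.

Lemma cabs_prod (I : finType) (F : I -> R[i]) : cabs (\prod_i F i) = \prod_i cabs (F i).
Proof. by apply: (big_morph _ cabsM); exact: Normc.normc1. Qed.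

Lemma cabsN z : cabs (- z) = cabs z.
Proof. by rewrite !cabsE; case: z => a b /=; rewrite !sqrrN. Qed.

Lemma cabsD z w : cabs (z + w) <= cabs z + cabs w.
Proof. exact: le_normcD. Qed.

Lemma cabsB z w : cabs (z - w) <= cabs z + cabs w.
Proof. by rewrite -(cabsN w) cabsD. Qed.

Lemma cabs_real x : cabs x%:C = `|x|.
Proof. by rewrite cabsE /= expr0n/= addr0 sqrtr_sqr. Qed.

Lemma norm_Re_le z : `|Re z| <= cabs z.
Proof. by rewrite cabsE -sqrtr_sqr ler_wsqrtr// lerDl sqr_ge0. Qed.

Lemma norm_Im_le z : `|Im z| <= cabs z.
Proof. by rewrite cabsE -sqrtr_sqr ler_wsqrtr// lerDr sqr_ge0. Qed.

Lemma cabs_le_ReIm z : cabs z <= `|Re z| + `|Im z|.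
Proof.
rewrite -(@ler_pXn2r _ 2)// ?nnegrE ?cabs_ge0 ?addr_ge0// cabs_sqr.
rewrite -(real_normK (num_real (Re z))) -(real_normK (num_real (Im z))).
have := normr_ge0 (Re z); have := normr_ge0 (Im z); nra.
Qed.

Lemma cabs_sum_le n (F : 'I_n -> R[i]) : cabs (\sum_i F i) <= \sum_i cabs (F i).
Proof.
elim/big_ind2 : _ => [|a b c d ab cd|//]; first by rewrite cabs0.
by apply: le_trans (cabsD _ _) _; exact: lerD.
Qed.

Lemma ReB z w : Re (z - w) = Re z - Re w. Proof. by case: z w => ? ? []. Qed.
Lemma ImB z w : Im (z - w) = Im z - Im w. Proof. by case: z w => ? ? []. Qed.

Lemma Re_sum n (F : 'I_n -> R[i]) : Re (\sum_i F i) = \sum_i Re (F i).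
Proof. by apply: (big_ind2 (fun z x => Re z = x)) => // -[? ?] ? [? ?] ? /= -> ->. Qed.

Lemma Im_sum n (F : 'I_n -> R[i]) : Im (\sum_i F i) = \sum_i Im (F i).
Proof. by apply: (big_ind2 (fun z x => Im z = x)) => // -[? ?] ? [? ?] ? /= -> ->. Qed.

Lemma ReMreal z x : Re (z * x%:C) = Re z * x.
Proof. by case: z => a b /=; ring. Qed.

Lemma ImMreal z x : Im (z * x%:C) = Im z * x.
Proof. by case: z => a b /=; ring. Qed.

Lemma cabs_dist_le z w : `|cabs z - cabs w| <= `|Re z - Re w| + `|Im z - Im w|.
Proof.
rewrite -ReB -ImB; apply: le_trans (cabs_le_ReIm _).
have h1 : cabs z <= cabs w + cabs (z - w).
  by have := cabsD w (z - w); rewrite addrC subrK.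
have h2 : cabs w <= cabs z + cabs (z - w).
  by have := cabsB z (z - w); rewrite opprB addrC subrK.
by rewrite ler_norml; apply/andP; split; lra.
Qed.

(** At real points the monomials are real, so the real and imaginary parts of the coefficients
    define the two series, under the same Cauchy bound. *)
Lemma analytic2_ReIm (f : R[i] -> R[i] -> R[i]) : analytic2_at0 f ->
  exists r, real_analytic2 r (fun x y => Re (f x%:C y%:C)) /\
            real_analytic2 r (fun x y => Im (f x%:C y%:C)).
Proof.
move=> [c [r [B [r0 [hc hf]]]]]; exists r.
have E n x y : \sum_(i < n) \sum_(j < n) c i j * x%:C ^+ i * y%:C ^+ j =
     \sum_(i < n) \sum_(j < n) c i j * (x ^+ i * y ^+ j)%:C.
  apply: eq_bigr => i _; apply: eq_bigr => j _.
  by rewrite rmorphM !rmorphXn mulrA.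
split.
- exists (fun i j => Re (c i j)), B; split => // [i j|x y hx hy].
    apply: le_trans (hc i j).
    by apply: ler_wpM2r; [exact/exprn_ge0/ltW|exact: norm_Re_le].
  apply/cvgrPdist_lt => e e0.
  have [||N hN] := hf x%:C y%:C _ _ e e0; rewrite ?cabs_real//.
  exists N => // n /= /hN; rewrite E; apply: le_lt_trans.
  rewrite distrC; apply: le_trans (norm_Re_le _); rewrite ReB Re_sum.
  rewrite le_eqVlt; apply/orP; left; apply/eqP; congr (`|_ - _|).
  apply: eq_bigr => i _; rewrite Re_sum; apply: eq_bigr => j _.
  by rewrite ReMreal mulrA.
- exists (fun i j => Im (c i j)), B; split => // [i j|x y hx hy].
    apply: le_trans (hc i j).
    by apply: ler_wpM2r; [exact/exprn_ge0/ltW|exact: norm_Im_le].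
  apply/cvgrPdist_lt => e e0.
  have [||N hN] := hf x%:C y%:C _ _ e e0; rewrite ?cabs_real//.
  exists N => // n /= /hN; rewrite E; apply: le_lt_trans.
  rewrite distrC; apply: le_trans (norm_Im_le _); rewrite ImB Im_sum.
  rewrite le_eqVlt; apply/orP; left; apply/eqP; congr (`|_ - _|).
  apply: eq_bigr => i _; rewrite Im_sum; apply: eq_bigr => j _.
  by rewrite ImMreal mulrA.
Qed.

Lemma analytic1_continuous0 (f : R[i] -> R[i]) : analytic1_at0 f ->
  forall e : R, 0 < e -> exists2 d, 0 < d & forall z, cabs z < d -> cabs (f z - f 0) < e.
Proof.
move=> [c [r [B [r0 [hc hf]]]]] e e0.
have B0 : 0 <= B.
  by apply: le_trans (hc 0%N); rewrite expr0 mulr1 cabs_ge0.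
have f0 : f 0 = c 0%N.
  apply/eqP; rewrite -subr_eq0 -cabs_eq0 eq_le cabs_ge0 andbT.
  apply/ler_addgt0Pr => d d0; rewrite add0r.
  have [|N /(_ N.+1 (leqnSn _))] := hf 0 _ d d0; first by rewrite cabs0.
  rewrite big_ord_recl expr0 mulr1 big1 ?addr0; last first.
    by move=> i _; rewrite expr0n/= mulr0.
  by rewrite -cabsN opprB => /ltW.
(* For |z| < r / 2 geometric domination gives |f z - f 0| <= (2B / r) |z|; the added 1 keeps the
   denominator positive when B = 0. *)
exists (Num.min (r / 2) (e / (B * 2 / r + 1) / 2)).
  by rewrite lt_min !divr_gt0// ltr_wpDl// divr_ge0 ?mulr_ge0// ltW.
move=> z; rewrite lt_min => /andP[zr ze].
have zr' : cabs z < r by lra.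
have key n : cabs (\sum_(i < n.+1) c i * z ^+ i - c 0%N) <= B * 2 / r * cabs z.
  rewrite big_ord_recl expr0 mulr1 addrC addKr.
  apply: le_trans (cabs_sum_le _) _.
  rewrite -[leLHS]ger0_norm; last by apply: sumr_ge0 => i _; exact: cabs_ge0.
  have -> : B * 2 / r * cabs z = B / r * cabs z * 2 by ring.
  apply: (@sum_geom_le _ n _ (fun i => cabs (c i.+1 * z ^+ i.+1))).
    by rewrite mulr_ge0 ?cabs_ge0// divr_ge0// ltW.
  move=> i; rewrite ger0_norm ?cabs_ge0// cabsM cabsX.
  apply: le_trans (_ : cabs (c i.+1) * (cabs z * (r / 2) ^+ i) <= _).
    rewrite ler_wpM2l ?cabs_ge0// exprS ler_wpM2l ?cabs_ge0//.
    by apply: lerXn2r; rewrite ?nnegrE ?cabs_ge0//; lra.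
  have := hc i.+1; rewrite exprS => h.
  have -> : cabs (c i.+1) * (cabs z * (r / 2) ^+ i) =
    (cabs (c i.+1) * (r * r ^+ i)) / r * cabs z * 2^-1 ^+ i.
    by rewrite exprMn; field; lra.
  rewrite ler_wpM2r ?exprn_ge0// ler_wpM2r ?cabs_ge0// ler_wpM2r// invr_ge0 ltW//.
have hlim : cabs (f z - f 0) <= B * 2 / r * cabs z.
  apply/ler_addgt0Pr => d d0.
  have [|N /(_ N.+1 (leqnSn _)) hN] := hf z _ d d0; first by [].
  have -> : f z - f 0 = (\sum_(i < N.+1) c i * z ^+ i - c 0%N) -
      (\sum_(i < N.+1) c i * z ^+ i - f z) by rewrite f0; ring.
  by apply: le_trans (cabsB _ _) _; apply: lerD (key N) (ltW hN).
apply: le_lt_trans hlim _.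
set A := B * 2 / r in ze *.
have A0 : 0 <= A by rewrite divr_ge0 ?mulr_ge0// ltW.
have : cabs z * (A + 1) < e / 2.
  rewrite -ltr_pdivlMr; last by lra.
  by rewrite mulrAC.
have := cabs_ge0 z; nra.
Qed.

Lemma analytic2_continuous0 (f : R[i] -> R[i] -> R[i]) : analytic2_at0 f ->
  forall e : R, 0 < e -> exists2 d, 0 < d &
    forall x y, `|x| < d -> `|y| < d -> cabs (f x%:C y%:C - f 0 0) < e.
Proof.
move=> /analytic2_ReIm[r [ar ai]] e e0.
have r0 : 0 < r by case: ar => c [B []].
have [C1 C10 h1] := real_analytic2_lipschitz ar.
have [C2 C20 h2] := real_analytic2_lipschitz ai.
exists (Num.min (r / 16) (e / 4 / (C1 + C2 + 1))).
  by rewrite lt_min !divr_gt0//; lra.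
move=> x y; rewrite !lt_min => /andP[x1 x2] /andP[y1 y2].
apply: le_lt_trans (cabs_le_ReIm _) _; rewrite ReB ImB.
have r16 : `|0 : R| < r / 16 by rewrite normr0; lra.
have := h1 0 0 x y r16 r16 x1 y1; have := h2 0 0 x y r16 r16 x1 y1.
rewrite !subr0 !ltr_pdivlMr in x2 y2 *; [|lra..].
have := normr_ge0 x; have := normr_ge0 y.
rewrite (_ : 0%:C = 0)//.
move=> ? ? ? ?; nra.
Qed.

(** The inverse of 1 plus the sum of all 1 / e_j is positive and below every e_j, also for an empty
    family. *)
Lemma fin_uniform (n : nat) (S : 'I_n -> R -> Prop) :
  (forall j e e', 0 < e' -> e' <= e -> S j e -> S j e') ->
  (forall j, exists2 e, 0 < e & S j e) -> exists2 e, 0 < e & forall j, S j e.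
Proof.
move=> mono ex.
have /choice[e he] : forall j, exists e : R, 0 < e /\ S j e.
  by move=> j; have [e ? ?] := ex j; exists e.
have s0 : 0 <= \sum_j (e j)^-1.
  by apply: sumr_ge0 => j _; rewrite invr_ge0 ltW//; have [] := he j.
exists (1 + \sum_j (e j)^-1)^-1; first by rewrite invr_gt0 ltr_wpDr.
move=> j; have [ej Sj] := he j; apply: mono Sj; first by rewrite invr_gt0 ltr_wpDr.
rewrite invf_ple ?posrE ?ltr_wpDr//.
rewrite (bigD1 j)//= addrCA lerDl addr_ge0// sumr_ge0// => i _.
by rewrite invr_ge0 ltW//; have [] := he i.
Qed.

End ComplexAbs.

(** * Comparison of P with its linear factors *)

Section AeBound.
Context {R : realType}.

(** A positive value of [h] would persist on a small box by the Lipschitz bound; the box would lie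
    in the negligible set although its measure is positive. *)
Lemma ae_le0_lipschitz (h : R -> R -> R) (s C : R) : 0 <= C ->
  (forall x y x' y', `|x| < s -> `|y| < s -> `|x'| < s -> `|y'| < s ->
    `|h x' y' - h x y| <= C * (`|x' - x| + `|y' - y|)) ->
  {ae @leb2 R, forall z, sq s z -> z.1 != 0 -> h z.1 z.2 <= 0} ->
  forall x y, x != 0 -> `|x| < s -> `|y| < s -> h x y <= 0.
Proof.
move=> C0 lip [N [mN N0 hN]] x y x0 xs ys; rewrite leNgt; apply/negP => hpos.
pose e := h x y / (C + 1) / 4.
have e0 : 0 < e by rewrite !divr_gt0// ltr_wpDl.
have eC : C * (e + e) < h x y.
  have : e * (C + 1) = h x y / 4 by rewrite /e; field; rewrite gt_eqF// ltr_wpDl.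
  nra.
have nx0 : 0 < `|x| by rewrite normr_gt0.
(* The box of half-side [d] avoids the line x = 0, stays in the square, and is too small for [h] to
   drop to 0. *)
pose d := Num.min (Num.min `|x| (s - `|x|)) (Num.min (s - `|y|) e).
have d0 : 0 < d by rewrite !lt_min nx0 e0 !subr_gt0 xs ys.
have : d <= d by [].
rewrite {2}/d !le_min => /andP[/andP[d1 d2] /andP[d3 d4]].
pose bx : set (R * R) := (`](x - d), (x + d)[%classic `*` `](y - d), (y + d)[%classic).
have sub : bx `<=` N.
  move=> [x' y'] [/=]; rewrite !in_itv/= => /andP[a1 a2] /andP[b1 b2].
  apply: hN => /=.
  have xd : `|x' - x| < d by rewrite ltr_norml; apply/andP; lra.
  have yd : `|y' - y| < d by rewrite ltr_norml; apply/andP; lra.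
  have x's : `|x'| < s.
    rewrite -(subrK x x'); apply: le_lt_trans (ler_normD _ _) _; lra.
  have y's : `|y'| < s.
    rewrite -(subrK y y'); apply: le_lt_trans (ler_normD _ _) _; lra.
  have x'0 : x' != 0.
    apply/eqP => x'0; move: xd; rewrite x'0 sub0r normrN; lra.
  move=> /(_ _ x'0); rewrite /sq/= !in_itv/= -!ltr_norml x's y's => /(_ (conj isT isT)).
  have := lip x y x' y' xs ys x's y's.
  rewrite ler_norml => /andP[l1 l2] h0.
  have : C * (`|x' - x| + `|y' - y|) <= C * (e + e).
    by rewrite ler_wpM2l// lerD//; lra.
  lra.
have mbx : measurable bx by apply: measurableX; exact: measurable_itv.
have : (@leb2 R bx <= 0)%E.
  by rewrite -N0; apply: le_measure => //; rewrite inE.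
rewrite /leb2 product_measure1E; [|exact: measurable_itv..].
rewrite -/lebesgue_measure.
have E (a : R) : @lebesgue_measure R (`](a - d), (a + d)[%classic) = (d + d)%:E.
  rewrite lebesgue_measure_itv/= lte_fin.
  have -> : a - d < a + d by lra.
  by rewrite -EFinB; congr (_%:E); ring.
rewrite [X in (X * _)%E](_ : _ = (d + d)%:E); last exact: E.
rewrite [X in (_ * X)%E](_ : _ = (d + d)%:E); last exact: E.
by rewrite -EFinM lee_fin leNgt; apply/negP; rewrite negbK mulr_gt0 ?addr_gt0.
Qed.

End AeBound.

Section Doubling.
Context {R : realType}.
Local Notation "x %:C" := (real_complex R x).

(** This is all that the derivative estimate retains of the factorization; [m j] is a lower bound
    for the modulus of the j-th factor. *)
Definition doubling (P : R -> R -> R[i]) (M : nat) (m : 'I_M -> R -> R -> R)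
    (s C : R) :=
  forall x y, x != 0 -> `|x| < s -> `|y| < s -> P x y != 0 /\
    forall d, 0 <= d -> (forall j, d <= m j x y) ->
      d ^+ M <= C * cabs (P x y) /\
      forall t, `|t| < s -> `|t - y| <= d -> cabs (P x t) <= C * cabs (P x y).

(** Write F for the modulus on the right. The imaginary part gives X <= F / e, then the real part
    gives |a| <= F + X / e; adding yields the constant. *)
Lemma factor_lower_bound (e a X : R) (w : R[i]) : 0 < e -> 0 <= X ->
  e <= complex.Im w -> `|complex.Re w| <= e^-1 ->
  (1 + e^-1 + e^-1 ^+ 2)^-1 * (`|a| + X) <= cabs (a%:C + X%:C * w).
Proof.
move=> e0 X0 he hr.
set F := cabs _.
have i0 : 0 < e^-1 by rewrite invr_gt0.
have k0 : 0 < 1 + e^-1 + e^-1 ^+ 2 by have := sqr_ge0 (e^-1); lra.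
have hF1 : X * e <= F.
  apply: le_trans (norm_Im_le _).
  have -> : complex.Im (a%:C + X%:C * w) = X * complex.Im w.
    by case: w {he hr F} => p q /=; ring.
  rewrite normrM (ger0_norm X0) ler_wpM2l//.
  by apply: le_trans he (ler_norm _).
have hF2 : `|a| <= F + X * e^-1.
  have -> : a = complex.Re (a%:C + X%:C * w) - X * complex.Re w.
    by case: w {he hr F hF1} => p q /=; ring.
  apply: le_trans (ler_normB _ _) _; apply: lerD; first exact: norm_Re_le.
  by rewrite normrM (ger0_norm X0) ler_wpM2l.
rewrite ler_pdivrMl//.
have : X <= F * e^-1 by rewrite ler_pdivlMr.
nra.
Qed.

Lemma root_small (k : nat) (z w : R[i]) (e : R) : (0 < k)%N -> 0 < e ->
  w ^+ k = z -> cabs z < e ^+ k -> cabs w < e.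
Proof.
move=> k0 e0 <-; rewrite cabsX ltr_pXn2r// nnegrE ?cabs_ge0//; exact: ltW.
Qed.

Lemma product_doubling (P u : R[i] -> R[i] -> R[i]) (M k : nat) (rho : R[i] -> R[i])
    (L : 'I_M -> nat) (q : 'I_M -> {poly R}) (psi : 'I_M -> R[i] -> R[i]) :
  analytic2_at0 u -> u 0 0 != 0 -> (1 <= k)%N ->
  (forall z : R[i], rho z ^+ k = z) ->
  (forall j, analytic1_at0 (psi j) /\ 0 < complex.Im (psi j 0)) ->
  (exists r : R, 0 < r /\ forall x y : R[i], cabs x < r -> cabs y < r ->
      P x y = u x y * \prod_(j < M)
        (y + (map_poly (real_complex R) (q j)).[x] + x ^+ (2 * L j) * psi j (rho x))) ->
  exists s kap C, [/\ 0 < s, 0 < kap, 0 <= C &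
    doubling (fun x y => P x%:C y%:C)
      (fun j x y => kap * (`|y + (q j).[x]| + `|x| ^+ (2 * L j))) s C].
Proof.
move=> au u0 k1 hrho hpsi [r [r0 hP]].
have U0 : 0 < cabs (u 0 0) by rewrite cabs_gt0.
set U := cabs (u 0 0) in U0.
have [du du0 hu] := analytic2_continuous0 au (divr_gt0 U0 (ltr0n _ 2)).
have ub x y : `|x| < du -> `|y| < du ->
    U / 2 <= cabs (u x%:C y%:C) /\ cabs (u x%:C y%:C) <= U * 2.
  move=> hx hy; have h := hu _ _ hx hy.
  have h1 : U <= cabs (u x%:C y%:C) + cabs (u x%:C y%:C - u 0 0).
    rewrite /U; have {1}-> : u 0 0 = u x%:C y%:C - (u x%:C y%:C - u 0 0) by ring.
    exact: cabsB.
  have h2 : cabs (u x%:C y%:C) <= U + cabs (u x%:C y%:C - u 0 0).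
    rewrite /U; have {1}-> : u x%:C y%:C = u 0 0 + (u x%:C y%:C - u 0 0) by ring.
    exact: cabsD.
  by split; lra.
(* A single [e] serves as radius, as lower bound for the imaginary part and as inverse of a bound
   for the real part. Each requirement weakens as [e] decreases, so one value suits all j. *)
have [e e0 he] : exists2 e : R, 0 < e & forall j z, cabs z < e ->
    e <= complex.Im (psi j z) /\ `|complex.Re (psi j z)| <= e^-1.
  apply: (@fin_uniform _ _ (fun j e => forall z, cabs z < e ->
    e <= complex.Im (psi j z) /\ `|complex.Re (psi j z)| <= e^-1)).
    move=> j e e' e'0 e'e S z ze'; have [|S1 S2] := S z; first exact: lt_le_trans e'e.
    split; first exact: le_trans S1.
    by apply: le_trans S2 _; rewrite lef_pV2 ?posrE//; apply: lt_le_trans e'e.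
  move=> j; have [aj ij] := hpsi j.
  set I0 := complex.Im (psi j 0) in ij.
  have [d d0 hd] := analytic1_continuous0 aj (divr_gt0 ij (ltr0n _ 2)).
  pose A := cabs (psi j 0) + I0 / 2.
  have A0 : 0 < A by rewrite ltr_wpDl ?cabs_ge0// divr_gt0.
  exists (Num.min d (Num.min (I0 / 2) A^-1)).
    by rewrite !lt_min d0 divr_gt0// invr_gt0.
  move=> z; rewrite lt_min => /andP[/hd zd _]; split.
    rewrite ge_min ge_min; apply/orP; right; apply/orP; left.
    have := le_lt_trans (norm_Im_le _) zd; rewrite ImB -/I0 ltr_norml => /andP[? ?].
    lra.
  apply: le_trans (_ : A <= _).
    apply: le_trans (norm_Re_le _) _.
    have -> : psi j z = psi j 0 + (psi j z - psi j 0) by ring.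
    by apply: le_trans (cabsD _ _) _; rewrite /A lerD2l ltW.
  rewrite -[A in leLHS]invrK lef_pV2 ?posrE ?invr_gt0//; last first.
    by rewrite !lt_min d0 divr_gt0// invr_gt0.
  by rewrite ge_min ge_min lexx !orbT.
pose kap := (1 + e^-1 + e^-1 ^+ 2)^-1.
have kap0 : 0 < kap.
  have i0 : 0 < e^-1 by rewrite invr_gt0.
  by rewrite invr_gt0; have := sqr_ge0 (e^-1); lra.
(* The radius e^k makes the k-th root of x smaller than e. As |u| lies between U / 2 and 2U, the
   term 2 / U serves the bound on d^M, and 4 * 2^M the comparison of P at t and at y. *)
exists (Num.min (Num.min r du) (e ^+ k)), kap, (4 * 2 ^+ M + 2 / U).
split => //.
- by rewrite !lt_min r0 du0 exprn_gt0.
- by rewrite addr_ge0 ?mulr_ge0 ?exprn_ge0 ?invr_ge0// ltW.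
move=> x y x0; rewrite !lt_min => /andP[/andP[xr xu] xe] /andP[/andP[yr yu] ye].
pose F j t := (t + (q j).[x])%:C + (x ^+ (2 * L j))%:C * psi j (rho x%:C).
have PE t : `|t| < r -> cabs (P x%:C t%:C) = cabs (u x%:C t%:C) * \prod_j cabs (F j t).
  move=> tr; rewrite hP ?cabs_real// cabsM cabs_prod; congr (_ * _).
  apply: eq_bigr => j _; congr (cabs (_ + _)).
    by rewrite horner_map rmorphD.
  by rewrite rmorphXn.
have rx : cabs (rho x%:C) < e.
  by apply: (root_small k1 e0 (hrho _)); rewrite cabs_real.
have Xpos j : x ^+ (2 * L j) = `|x| ^+ (2 * L j).
  by rewrite !exprM real_normK// num_real.
have Flb j t : kap * (`|t + (q j).[x]| + `|x| ^+ (2 * L j)) <= cabs (F j t).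
  have [h1 h2] := he j _ rx.
  by rewrite -Xpos; apply: factor_lower_bound => //; rewrite Xpos exprn_ge0.
have Fpos j t : 0 < cabs (F j t).
  apply: lt_le_trans (Flb j t); rewrite mulr_gt0// ltr_wpDl// exprn_gt0//.
  by rewrite normr_gt0.
have prodpos t : 0 < \prod_j cabs (F j t) by apply: prodr_gt0.
have [ul uu] := ub _ _ xu yu.
have Pl : U / 2 * \prod_j cabs (F j y) <= cabs (P x%:C y%:C).
  by rewrite PE// ler_wpM2r// ltW.
split; first by rewrite -cabs_gt0 PE// mulr_gt0//; apply: lt_le_trans ul; rewrite divr_gt0.
move=> d d0 hd.
have dF j : d <= cabs (F j y) by apply: le_trans (hd j) (Flb j y).
set p := \prod_j cabs (F j y) in Pl.
have p0 : 0 < p := prodpos y.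
have pP : p <= 2 / U * cabs (P x%:C y%:C).
  apply: le_trans (ler_wpM2l _ Pl); last by rewrite divr_ge0// ltW.
  by rewrite mulrA (_ : 2 / U * (U / 2) = 1) ?mul1r//; field; rewrite gt_eqF.
have P0 := cabs_ge0 (P x%:C y%:C).
split.
  apply: le_trans (_ : p <= _).
    have -> : d ^+ M = \prod_(j < M) d by rewrite prodr_const card_ord.
    by apply: ler_prod => j _; rewrite d0 dF.
  apply: le_trans pP _; rewrite ler_wpM2r// lerDr mulr_ge0// exprn_ge0//.
move=> t; rewrite !lt_min => /andP[/andP[tr tu] te] ty.
rewrite PE//.
have [_ ut] := ub _ _ xu tu.
apply: le_trans (_ : U * 2 * (2 ^+ M * p) <= _).
  apply: ler_pM; rewrite ?cabs_ge0 ?(ltW (prodpos _))//.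
  have -> : 2 ^+ M = \prod_(j < M) (2 : R) by rewrite prodr_const card_ord.
  rewrite -big_split/=; apply: ler_prod => j _; rewrite cabs_ge0/=.
  (* The factor moves by |t - y| <= d <= |F_j(y)|, so its modulus at most doubles. *)
  have -> : F j t = F j y + (t - y)%:C by rewrite /F !rmorphD rmorphN; ring.
  apply: le_trans (cabsD _ _) _; rewrite cabs_real.
  by have := dF j; lra.
have M0 : 0 <= 2 ^+ M :> R by rewrite exprn_ge0.
have -> : U * 2 * (2 ^+ M * p) = 4 * 2 ^+ M * (U / 2 * p) by field.
apply: le_trans (_ : 4 * 2 ^+ M * cabs (P x%:C y%:C) <= _).
  by rewrite ler_wpM2l// mulr_ge0.
by rewrite ler_wpM2r// lerDl divr_ge0// ltW.
Qed.

End Doubling.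

(** * The derivative of the quotient *)

Section Quotient.
Context {R : realType}.
Local Notation Re := complex.Re.
Local Notation Im := complex.Im.
Local Notation "x %:C" := (real_complex R x).

Lemma ReDiv (z w : R[i]) :
  Re (z / w) = (Re z * Re w + Im z * Im w) / (Re w ^+ 2 + Im w ^+ 2).
Proof. by case: z w => a b [c d] /=; ring. Qed.

Lemma ImDiv (z w : R[i]) :
  Im (z / w) = (Im z * Re w + - Re z * Im w) / (Re w ^+ 2 + Im w ^+ 2).
Proof. by case: z w => a b [c d] /=; ring. Qed.

(* The derivative of (a u + b v) / (u^2 + v^2), which covers both the real part
   (a, b) = (Re Q, Im Q) and the imaginary part (a, b) = (Im Q, - Re Q) of Q / P. *)
Definition dquot (a b u v a' b' u' v' : R) : R :=
  ((a' * u + a * u' + b' * v + b * v') * (u ^+ 2 + v ^+ 2)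
   - (a * u + b * v) * (2 * u * u' + 2 * v * v')) / (u ^+ 2 + v ^+ 2) ^+ 2.

Lemma is_derive_quot (a b u v : R -> R) (y a' b' u' v' : R) :
  u y ^+ 2 + v y ^+ 2 != 0 ->
  is_derive y (1 : R) a a' -> is_derive y (1 : R) b b' ->
  is_derive y (1 : R) u u' -> is_derive y (1 : R) v v' ->
  is_derive y (1 : R) (fun t => (a t * u t + b t * v t) / (u t ^+ 2 + v t ^+ 2))
    (dquot (a y) (b y) (u y) (v y) a' b' u' v').
Proof.
move=> n0 da db du dv.
pose n : R -> R := u ^+ 2 + v ^+ 2.
have dn : is_derive y (1 : R) n (2 * u y * u' + 2 * v y * v').
  have du2 : is_derive y (1 : R) (u ^+ 2) _ := is_deriveX 2 du.
  have dv2 : is_derive y (1 : R) (v ^+ 2) _ := is_deriveX 2 dv.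
  apply: (is_derive_eq (is_deriveD du2 dv2)).
  by rewrite /GRing.scale/= !expr1.
rewrite [X in is_derive _ _ X _](_ : _ = (a * u + b * v) * (fun t => (n t)^-1)); last first.
  by apply/funext.
have dV := is_deriveV (n0 : n y != 0) dn.
apply: (is_derive_eq (is_deriveM (is_deriveD (is_deriveM da du) (is_deriveM db dv)) dV)).
rewrite /GRing.scale/= /dquot /n.
have -> : (u ^+ 2 + v ^+ 2) y = u y ^+ 2 + v y ^+ 2 by [].
have -> : (a * u + b * v) y = a y * u y + b y * v y by [].
by field.
Qed.

(** Every term of the numerator contains exactly one derivative, so one factor [d] suffices to bound
    it by a multiple of p^4, the denominator. The 10 is 2 from the first product plus 2 * 4 from the
    second. *)
Lemma dquot_bound (a b u v a' b' u' v' p B A d : R) : 0 < p -> 0 <= B -> 0 <= A ->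
  0 <= d -> u ^+ 2 + v ^+ 2 = p ^+ 2 ->
  `|a| <= B * p -> `|b| <= B * p -> `|u| <= p -> `|v| <= p ->
  `|a'| * d <= A * p -> `|b'| * d <= A * p -> `|u'| * d <= A * p -> `|v'| * d <= A * p ->
  `|dquot a b u v a' b' u' v'| * d <= 2 * A + 10 * (A * B).
Proof.
move=> p0 B0 A0 d0 E ha hb hu hv ha' hb' hu' hv'.
have mul (x y X Y : R) : `|x| <= X -> `|y| * d <= Y -> `|x * y| * d <= X * Y.
  by move=> hx hy; rewrite normrM -mulrA; apply: ler_pM => //; rewrite mulr_ge0.
have p4 : 0 < p ^+ 4 by rewrite exprn_gt0.
rewrite /dquot E normrM normfV -exprM [`|p ^+ _|]ger0_norm ?(ltW p4)//.
rewrite mulrAC ler_pdivrMr//.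
set N1 := a' * u + a * u' + b' * v + b * v'; set N2 := a * u + b * v.
set N3 := 2 * u * u' + 2 * v * v'.
have nd (x y : R) : `|x + y| * d <= `|x| * d + `|y| * d.
  by rewrite -mulrDl ler_wpM2r// ler_normD.
have h1 : `|N1| * d <= 2 * A * p ^+ 2 + 2 * (A * B) * p ^+ 2.
  have := nd (a' * u + a * u' + b' * v) (b * v').
  have := nd (a' * u + a * u') (b' * v); have := nd (a' * u) (a * u').
  rewrite (mulrC a') (mulrC b').
  have := mul _ _ _ _ hu ha'; have := mul _ _ _ _ hv hb'.
  have := mul _ _ _ _ ha hu'; have := mul _ _ _ _ hb hv'.
  rewrite /N1 (mulrC a') (mulrC b').
  have -> : p * (A * p) = A * p ^+ 2 by ring.
  have -> : B * p * (A * p) = A * B * p ^+ 2 by ring.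
  lra.
have h2 : `|N2| <= 2 * B * p ^+ 2.
  apply: le_trans (ler_normD _ _) _; rewrite !normrM.
  have := ler_pM (normr_ge0 _) (normr_ge0 _) ha hu.
  have := ler_pM (normr_ge0 _) (normr_ge0 _) hb hv.
  have -> : B * p * p = B * p ^+ 2 by ring.
  lra.
have h3 : `|N3| * d <= 4 * A * p ^+ 2.
  rewrite /N3 -!mulrA -mulrDr normrM ger0_norm//.
  have := nd (u * u') (v * v').
  have := mul _ _ _ _ hu hu'; have := mul _ _ _ _ hv hv'.
  have -> : p * (A * p) = A * p ^+ 2 by ring.
  lra.
apply: le_trans (ler_wpM2r d0 (ler_normB _ _)) _.
rewrite mulrDl (normrM N1) (normrM N2) (ger0_norm (sqr_ge0 p)).
have -> : (2 * A + 10 * (A * B)) * p ^+ 4 =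
  (2 * A * p ^+ 2 + 2 * (A * B) * p ^+ 2) * p ^+ 2 + (2 * B * p ^+ 2) * (4 * A * p ^+ 2).
  ring.
apply: lerD; first by rewrite mulrAC ler_wpM2r ?sqr_ge0.
by rewrite -mulrA; apply: ler_pM => //; rewrite mulr_ge0.
Qed.

Lemma measurable_inv_nneg (D : set (R * R)) (f : R * R -> R) :
  (forall z, 0 <= f z) -> measurable_fun D f -> measurable_fun D (fun z => (f z)^-1).
Proof.
move=> f0 mf.
rewrite (_ : (fun z => _) = (fun z => f z `^ (-1))); last first.
  by apply/funext => z; rewrite powR_inv1.
exact: (measurableT_comp (@measurable_powR R (-1)) mf).
Qed.

Lemma measurable_dquot (D : set (R * R)) (a b u v a' b' u' v' : R * R -> R) :
  measurable_fun D a -> measurable_fun D b -> measurable_fun D u -> measurable_fun D v ->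
  measurable_fun D a' -> measurable_fun D b' -> measurable_fun D u' -> measurable_fun D v' ->
  measurable_fun D (fun z =>
    dquot (a z) (b z) (u z) (v z) (a' z) (b' z) (u' z) (v' z)).
Proof.
move=> ma mb mu mv ma' mb' mu' mv'; rewrite /dquot.
have mn : measurable_fun D (fun z => u z ^+ 2 + v z ^+ 2).
  by apply: measurable_funD; exact: measurable_funX.
apply: measurable_funM; last first.
  by apply: measurable_inv_nneg => [z|]; [exact: sqr_ge0|exact: measurable_funX].
apply: measurable_funB.
  apply: measurable_funM => //.
  by do 3?[apply: measurable_funD]; exact: measurable_funM.
apply: measurable_funM; first by apply: measurable_funD; exact: measurable_funM.
apply: measurable_funD; apply: measurable_funM => //; apply: measurable_funM => //.
Qed.

Lemma measurable_fun_sub_sq (s r : R) (f : R * R -> R) : s <= r ->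
  measurable_fun (sq r) f -> measurable_fun (sq s) f.
Proof.
move=> sr; apply: measurable_funS; first exact: measurable_sq.
by move=> [x y] [/=]; rewrite /sq/= !in_itv/= => /andP[? ?] /andP[? ?]; split; apply/andP; lra.
Qed.

Lemma quotient_derivative (P Q : R[i] -> R[i] -> R[i]) (M : nat)
    (m : 'I_M -> R -> R -> R) (s0 kap C B : R) :
  0 < s0 -> 0 < kap -> 0 <= C -> 0 <= B ->
  analytic2_at0 P -> analytic2_at0 Q ->
  doubling (fun x y => P x%:C y%:C) (fun j x y => kap * m j x y) s0 C ->
  (forall x y, x != 0 -> `|x| < s0 -> `|y| < s0 ->
     cabs (Q x%:C y%:C) <= B * cabs (P x%:C y%:C)) ->
  exists (g : R * R -> R[i]) s A, [/\ 0 < s, 0 <= A, cmeasurable (sq s) g,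
    (forall x y, `|x| < s -> `|y| < s -> P x%:C y%:C != 0 ->
      is_derive y (1 : R) (fun t : R => Re (Q x%:C t%:C / P x%:C t%:C)) (Re (g (x, y))) /\
      is_derive y (1 : R) (fun t : R => Im (Q x%:C t%:C / P x%:C t%:C)) (Im (g (x, y)))) &
    (forall x y d, x != 0 -> `|x| < s -> `|y| < s -> 0 <= d -> d <= 1 ->
      (forall j, d <= m j x y) -> cabs (g (x, y)) * d <= A)].
Proof.
move=> s00 kap0 C0 B0 /analytic2_ReIm[rP [aPr aPi]] /analytic2_ReIm[rQ [aQr aQi]] dbl QP.
pose pr x y := Re (P x%:C y%:C). pose pi x y := Im (P x%:C y%:C).
pose qr x y := Re (Q x%:C y%:C). pose qi x y := Im (Q x%:C y%:C).
have [pr' [s1 [W1 [s10 s1r W10 apr' [dpr mpr]]]]] := real_analytic2_markov M aPr.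
have [pi' [s2 [W2 [s20 s2r W20 api' [dpi mpi]]]]] := real_analytic2_markov M aPi.
have [qr' [s3 [W3 [s30 s3r W30 aqr' [dqr mqr]]]]] := real_analytic2_markov M aQr.
have [qi' [s4 [W4 [s40 s4r W40 aqi' [dqi mqi]]]]] := real_analytic2_markov M aQi.
(* The halves leave room for the interval from y to y + dk, of length at most s. *)
have [s [sp ss1 ss2 ss3 ss4] ss0] : exists2 s, [/\ 0 < s, s <= s1 / 2, s <= s2 / 2,
    s <= s3 / 2 & s <= s4 / 2] & s <= s0 / 2.
  exists (Num.min (s0 / 2) (Num.min (Num.min (s1 / 2) (s2 / 2)) (Num.min (s3 / 2) (s4 / 2)))).
    by split; rewrite ?lt_min ?ge_min ?divr_gt0 ?lexx ?orbT.
  by rewrite ge_min lexx.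
have [lP lQ l0] : [/\ s <= rP, s <= rQ & s <= s0].
  by split; clear -sp ss1 ss3 ss0 s1r s3r s10 s30 s00; lra.
have [l1 l2 l3 l4] : [/\ s <= s1, s <= s2, s <= s3 & s <= s4].
  by clear -sp ss1 ss2 ss3 ss4; split; lra.
(* The formula defines [g] everywhere, with value 0 at the zeros of P since the inverse of 0 is 0;
   measurability therefore needs no case distinction. *)
pose g (z : R * R) : R[i] := complex.Complex
  (dquot (qr z.1 z.2) (qi z.1 z.2) (pr z.1 z.2) (pi z.1 z.2)
         (qr' z.1 z.2) (qi' z.1 z.2) (pr' z.1 z.2) (pi' z.1 z.2))
  (dquot (qi z.1 z.2) (- qr z.1 z.2) (pr z.1 z.2) (pi z.1 z.2)
         (qi' z.1 z.2) (- qr' z.1 z.2) (pr' z.1 z.2) (pi' z.1 z.2)).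
pose W := W1 + W2 + W3 + W4.
have W0 : 0 <= W by rewrite !addr_ge0.
have [w1 w2 w3 w4] : [/\ W1 <= W, W2 <= W, W3 <= W & W4 <= W].
  by rewrite /W; clear -W10 W20 W30 W40; split; lra.
(* For d <= 1 the rescaled length k d is below every kap m_j as [doubling] requires, below 1 so that
   its power M + 2 is at most its power M, and below s. *)
pose k := Num.min (Num.min kap 1) s.
have k0 : 0 < k by rewrite !lt_min kap0 sp ltr01.
have [kkap k1 ks] : [/\ k <= kap, k <= 1 & k <= s] by rewrite !ge_min !lexx !orbT.
(* On the interval |P| <= C p and |Q| <= B C p, both at most (B + 1) C p; the last C accounts for
   the Taylor error, at most C p. *)
pose A := W * ((B + 1) * C + C).
have A0 : 0 <= A by rewrite mulr_ge0// addr_ge0// mulr_ge0// addr_ge0.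
have K0 : 0 <= (2 * A + 10 * (A * B)) * 2 / k.
  rewrite divr_ge0 ?(ltW k0)// mulr_ge0// addr_ge0//; first by rewrite mulr_ge0.
  by rewrite mulr_ge0// mulr_ge0.
(* The 2 adds the real and imaginary parts, and 1 / k undoes the rescaling of d. *)
exists g, s, ((2 * A + 10 * (A * B)) * 2 / k); split => //.
- have [m1 m2 m3 m4] : [/\ measurable_fun (sq s) (fun z => pr z.1 z.2),
     measurable_fun (sq s) (fun z => pi z.1 z.2),
     measurable_fun (sq s) (fun z => qr z.1 z.2) &
     measurable_fun (sq s) (fun z => qi z.1 z.2)].
    split.
    - exact: measurable_fun_sub_sq lP (real_analytic2_measurable aPr).
    - exact: measurable_fun_sub_sq lP (real_analytic2_measurable aPi).
    - exact: measurable_fun_sub_sq lQ (real_analytic2_measurable aQr).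
    - exact: measurable_fun_sub_sq lQ (real_analytic2_measurable aQi).
  have [m1' m2' m3' m4'] : [/\ measurable_fun (sq s) (fun z => pr' z.1 z.2),
     measurable_fun (sq s) (fun z => pi' z.1 z.2),
     measurable_fun (sq s) (fun z => qr' z.1 z.2) &
     measurable_fun (sq s) (fun z => qi' z.1 z.2)].
    split.
    - exact: measurable_fun_sub_sq l1 (real_analytic2_measurable apr').
    - exact: measurable_fun_sub_sq l2 (real_analytic2_measurable api').
    - exact: measurable_fun_sub_sq l3 (real_analytic2_measurable aqr').
    - exact: measurable_fun_sub_sq l4 (real_analytic2_measurable aqi').
  split; apply: measurable_dquot => //; exact: measurable_funN.
- move=> x y xs ys P0.
  have n0 : pr x y ^+ 2 + pi x y ^+ 2 != 0.
    by rewrite -cabs_sqr expf_neq0// cabs_eq0.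
  have d1 : is_derive y (1 : R) (pr x) (pr' x y) by apply: dpr; exact: lt_le_trans l1.
  have d2 : is_derive y (1 : R) (pi x) (pi' x y) by apply: dpi; exact: lt_le_trans l2.
  have d3 : is_derive y (1 : R) (qr x) (qr' x y) by apply: dqr; exact: lt_le_trans l3.
  have d4 : is_derive y (1 : R) (qi x) (qi' x y) by apply: dqi; exact: lt_le_trans l4.
  split.
    rewrite (_ : (fun t => _) = fun t => (qr x t * pr x t + qi x t * pi x t) /
       (pr x t ^+ 2 + pi x t ^+ 2)); last by apply/funext => t; rewrite ReDiv.
    exact: is_derive_quot.
  rewrite (_ : (fun t => _) = fun t => (qi x t * pr x t + (- qr x) t * pi x t) /
     (pr x t ^+ 2 + pi x t ^+ 2)); last by apply/funext => t; rewrite ImDiv.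
  exact: is_derive_quot.
move=> x y d x0 xs ys d0 d1 hd.
have [P0 dd] := dbl x y x0 (lt_le_trans xs l0) (lt_le_trans ys l0).
pose dk := k * d.
have dk0 : 0 <= dk by rewrite mulr_ge0// ltW.
have dk1 : dk <= 1 by rewrite /dk -[leRHS]mulr1; apply: ler_pM => //; exact: ltW.
have dks : dk <= s by rewrite /dk -[leRHS]mulr1; apply: ler_pM => //; exact: ltW.
have [|dM dP] := dd dk dk0.
  by move=> j; apply: ler_pM => //; exact: ltW.
set p := cabs (P x%:C y%:C) in dM dP.
have p0 : 0 < p by rewrite cabs_gt0.
have hdM : dk ^+ M.+2 <= C * p.
  by apply: le_trans dM; rewrite -[M.+2]addn2 exprD ler_piMr ?exprn_ge0// exprn_ile1.
have tb t : y <= t <= y + dk -> cabs (P x%:C t%:C) <= C * p /\ cabs (Q x%:C t%:C) <= B * (C * p).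
  move=> /andP[t1 t2].
  have ts : `|t| < s0.
    move: ys; rewrite !ltr_norml => /andP[y1 y2]; apply/andP.
    by clear -sp ss0 t1 t2 dk0 dks y1 y2; split; lra.
  have ty : 0 <= t - y by rewrite subr_ge0.
  have h : cabs (P x%:C t%:C) <= C * p.
    by apply: dP => //; rewrite ger0_norm// lerBlDl.
  split => //; apply: le_trans (QP _ _ x0 _ ts) _; last by rewrite ler_wpM2l.
  exact: lt_le_trans l0.
have Cp0 : 0 <= C * p by rewrite mulr_ge0// ltW.
have fin (w f : R) : 0 <= w -> w <= W ->
    f <= w * ((B + 1) * (C * p) + dk ^+ M.+2) -> f <= A * p.
  move=> w0 wW /le_trans; apply.
  have -> : A * p = W * ((B + 1) * (C * p) + C * p) by rewrite /A; ring.
  by apply: ler_pM => //; rewrite ?lerD2l// addr_ge0 ?exprn_ge0// mulr_ge0// addr_ge0.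
have eB : B * (C * p) <= (B + 1) * (C * p) by rewrite ler_wpM2r// lerDl.
have e1 : C * p <= (B + 1) * (C * p) by rewrite ler_peMl// lerDr.
have b1 : `|pr' x y| * dk <= A * p.
  apply: (fin W1) => //.
  apply: mpr; rewrite ?dk0 ?(lt_le_trans xs l1) ?(lt_le_trans ys ss1) ?(le_trans dks ss1)//.
  by move=> t /tb[h _]; apply: le_trans (norm_Re_le _) (le_trans h _).
have b2 : `|pi' x y| * dk <= A * p.
  apply: (fin W2) => //.
  apply: mpi; rewrite ?dk0 ?(lt_le_trans xs l2) ?(lt_le_trans ys ss2) ?(le_trans dks ss2)//.
  by move=> t /tb[h _]; apply: le_trans (norm_Im_le _) (le_trans h _).
have b3 : `|qr' x y| * dk <= A * p.
  apply: (fin W3) => //.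
  apply: mqr; rewrite ?dk0 ?(lt_le_trans xs l3) ?(lt_le_trans ys ss3) ?(le_trans dks ss3)//.
  by move=> t /tb[_ h]; apply: le_trans (norm_Re_le _) (le_trans h _).
have b4 : `|qi' x y| * dk <= A * p.
  apply: (fin W4) => //.
  apply: mqi; rewrite ?dk0 ?(lt_le_trans xs l4) ?(lt_le_trans ys ss4) ?(le_trans dks ss4)//.
  by move=> t /tb[_ h]; apply: le_trans (norm_Im_le _) (le_trans h _).
have Qb : cabs (Q x%:C y%:C) <= B * p by apply: QP => //; exact: lt_le_trans l0.
have c1 : `|pr x y| <= p := norm_Re_le _.
have c2 : `|pi x y| <= p := norm_Im_le _.
have c3 : `|qr x y| <= B * p := le_trans (norm_Re_le _) Qb.
have c4 : `|qi x y| <= B * p := le_trans (norm_Im_le _) Qb.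
have E : pr x y ^+ 2 + pi x y ^+ 2 = p ^+ 2 by rewrite -cabs_sqr.
rewrite ler_pdivlMr// -mulrA [d * k]mulrC -/dk.
apply: le_trans (ler_wpM2r dk0 (cabs_le_ReIm _)) _; rewrite mulrDl.
have -> : (2 * A + 10 * (A * B)) * 2 =
  (2 * A + 10 * (A * B)) + (2 * A + 10 * (A * B)) by ring.
apply: lerD; apply: (dquot_bound p0) => //; by rewrite normrN.
Qed.

End Quotient.

(** * Integrability *)

Section LpBound.
Context {R : realType}.

(* The split [p = a + (p - a)] with [a < 1] separates the variables: the first
   factor is integrable in [y], the second one in [x]. *)
Lemma power_le_weight2 (p a x y : R) (q : {poly R}) (n : nat) :
  0 <= a -> a <= p -> x != 0 ->
  (((`|y + q.[x]| + `|x| ^+ n) `^ (- p))%:E <=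
    weight a (y + q.[x]) * weight (n%:R * (p - a)) x)%E.
Proof.
move=> a0 ap x0; set t := _ + _.
have nx : 0 < `|x| by rewrite normr_gt0.
have X0 : 0 < `|x| ^+ n by rewrite exprn_gt0.
have t0 : 0 < t by rewrite ltr_wpDl.
have -> : t `^ (- p) = t `^ (- a) * t `^ (- (p - a)).
  by rewrite -powRD; [congr (_ `^ _); ring|rewrite (gt_eqF t0) implybT].
rewrite EFinM; apply: lee_pmul; rewrite ?lee_fin ?powR_ge0//.
  by apply: weight_ge => //; rewrite lerDl ltW.
apply: le_trans (@weight_ge _ _ x `|x| _ nx (lexx _)); last first.
  by rewrite mulr_ge0// subr_ge0.
rewrite lee_fin !powRN lef_pV2 ?posrE ?powR_gt0//.
rewrite powRrM powR_mulrn; last exact: ltW.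
by apply: ge0_ler_powR; rewrite ?subr_ge0 ?nnegrE ?(ltW X0) ?(ltW t0)// lerDr.
Qed.

Lemma Lp_loc_of_bound (p s A : R) (M : nat) (L : 'I_M -> nat)
    (q : 'I_M -> {poly R}) (g : R * R -> R[i]) :
  1 <= p -> p * (\max_(j < M) (2 * L j))%N%:R < (\max_(j < M) (2 * L j))%N%:R + 1 ->
  0 < s -> 0 <= A -> cmeasurable (sq s) g ->
  (forall x y d, x != 0 -> `|x| < s -> `|y| < s -> 0 <= d -> d <= 1 ->
      (forall j, d <= `|y + (q j).[x]| + `|x| ^+ (2 * L j)) -> cabs (g (x, y)) * d <= A) ->
  Lp_loc p g.
Proof.
set K := (\max_(j < M) (2 * L j))%N.
move=> p1 pK s0 A0 mg hg; exists s; split => //; split => //.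
have p0 : 0 < p by lra.
have K0 : 0 <= K%:R :> R by [].
(* The gap 1 - K(p - 1) is positive by the assumption on p. Half of it is spent, so that K(p - 1 +
   del) < 1; dividing by K + 1 also covers K = 0. *)
pose del := (1 - K%:R * (p - 1)) / 2 / (K%:R + 1).
have K1 : 0 < K%:R + 1 :> R by lra.
have del0 : 0 < del by rewrite !divr_gt0//; lra.
have delK : del * (K%:R + 1) = (1 - K%:R * (p - 1)) / 2.
  by rewrite /del; field; rewrite gt_eqF.
have del1 : del < 1 by nra.
have Kdel : K%:R * (p - 1 + del) < 1 by nra.
pose a := 1 - del.
have a0 : 0 <= a by rewrite /a; lra.
have a1 : a < 1 by rewrite /a; lra.
have ap : a <= p by rewrite /a; lra.
have LK j : (2 * L j <= K)%N by exact: (@leq_bigmax _ (fun j => 2 * L j)%N).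
have g1 j : (2 * L j)%:R * (p - a) < 1.
  apply: le_lt_trans Kdel; rewrite /a.
  have -> : p - 1 + del = p - (1 - del) by ring.
  by rewrite ler_wpM2r ?ler_nat//; lra.
have g0 j : 0 <= (2 * L j)%:R * (p - a) by rewrite mulr_ge0// subr_ge0.
(* [w0] is at least 1 everywhere and infinite for x = 0. The weight of exponent 0 only gives it the
   same shape as the [w j]. *)
pose w0 (z : R * R) := (weight 0 (z.2 + (0 : {poly R}).[z.1]) * weight 2^-1 z.1)%E.
pose w j (z : R * R) := (weight a (z.2 + (q j).[z.1]) * weight ((2 * L j)%:R * (p - a)) z.1)%E.
have w00 z : (0 <= w0 z)%E by exact: weight2_ge0.
have wj0 j z : (0 <= w j z)%E by exact: weight2_ge0.
have mw0 : measurable_fun (sq s) w0 by exact: measurable_weight2.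
have mw j : measurable_fun (sq s) (w j) by exact: measurable_weight2.
have mS : measurable_fun (sq s) (fun z => \sum_(j < M) w j z)%E.
  by apply: emeasurable_sum.
have S0 z : (0 <= \sum_(j < M) w j z)%E by apply: sume_ge0.
(* Strictly positive even for A = 0, so that its product with an infinite weight remains
   infinite. *)
pose A' := (A + 1) `^ p.
have A'0 : 0 < A' by rewrite powR_gt0//; lra.
have bound z : sq s z -> ((cabs (g z) `^ p)%:E <= A'%:E * (w0 z + \sum_(j < M) w j z))%E.
  case: z => x y [/=]; rewrite !in_itv/= -!ltr_norml => xs ys.
  have [->|x0] := eqVneq x 0.
    rewrite /w0/= weight_half0 gt0_muley; last exact: lt_le_trans (weight_ge1 _ _).
    by rewrite addye ?gt0_muley ?leey ?lte_fin// -ltNye (lt_le_trans _ (S0 _)).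
  pose m j := `|y + (q j).[x]| + `|x| ^+ (2 * L j).
  have m0 j : 0 < m j by rewrite ltr_wpDl// exprn_gt0// normr_gt0.
  (* [d] = D^(-1/p) replaces the minimum of 1 and the m_j: it lies below all of them, while d^(-p) =
     D is a sum whose terms are integrated separately. *)
  pose D := 1 + \sum_j m j `^ (- p).
  have sm0 : 0 <= \sum_j m j `^ (- p) by apply: sumr_ge0 => j _; exact: powR_ge0.
  have D1 : 1 <= D by rewrite lerDl.
  have D0 : 0 < D by lra.
  pose d := D `^ (- p^-1).
  have d0 : 0 < d by rewrite powR_gt0.
  have ip0 : 0 < p^-1 by rewrite invr_gt0.
  have d1 : d <= 1.
    rewrite /d powRN invf_le1 ?powR_gt0//.
    rewrite -[leLHS](congr1 (@^~ p^-1) (@powR1 R)).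
    by apply: ge0_ler_powR; rewrite ?nnegrE ?(ltW ip0) ?(ltW D0).
  have dm j : d <= m j.
    have mE : m j = (m j `^ (- p)) `^ (- p^-1).
      by rewrite -powRrM mulrNN mulfV ?gt_eqF// powRr1// ltW.
    rewrite [leRHS]mE /d [leLHS]powRN [leRHS]powRN lef_pV2 ?posrE ?powR_gt0 ?powR_gt0//.
    apply: ge0_ler_powR; rewrite ?nnegrE ?powR_ge0 ?(ltW ip0) ?(ltW D0)//.
    rewrite /D (bigD1 j)//= addrCA lerDl addr_ge0// sumr_ge0// => i _.
    exact: powR_ge0.
  have gd : cabs (g (x, y)) <= A * D `^ p^-1.
    have := hg x y d x0 xs ys (ltW d0) d1 dm.
    by rewrite /d powRN ler_pdivrMr ?powR_gt0.
  have gD : cabs (g (x, y)) `^ p <= A' * D.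
    apply: (@le_trans _ _ ((A * D `^ p^-1) `^ p)).
      by apply: ge0_ler_powR; rewrite ?nnegrE ?cabs_ge0 ?(ltW p0) ?mulr_ge0 ?powR_ge0.
    rewrite powRM ?powR_ge0// -powRrM mulVf ?gt_eqF// powRr1 ?(ltW D0)//.
    rewrite ler_wpM2r ?(ltW D0)//.
    by apply: ge0_ler_powR; rewrite ?nnegrE ?(ltW p0) ?addr_ge0// lerDl.
  apply: (@le_trans _ _ (A' * D)%:E); first by rewrite lee_fin.
  rewrite EFinM lee_wpmul2l ?lee_fin ?(ltW A'0)// /D EFinD -sumEFin.
  apply: leeD; last first.
    by apply: lee_sum => j _; exact: power_le_weight2.
  by rewrite -[1%:E]mule1; apply: lee_pmul; rewrite ?lee01 ?weight_ge1.
have mgp : measurable_fun (sq s) (fun z => (cabs (g z) `^ p)%:E).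
  apply/measurable_EFinP; apply: (measurableT_comp (@measurable_powR R p)).
  case: mg => mr mi.
  rewrite (_ : (fun z => cabs (g z)) = (fun z =>
    (complex.Re (g z) ^+ 2 + complex.Im (g z) ^+ 2) `^ 2^-1)); last first.
    by apply/funext => z; rewrite cabsE powR12_sqrt// addr_ge0 ?sqr_ge0.
  apply: (measurableT_comp (@measurable_powR R 2^-1)).
  by apply: measurable_funD; exact: measurable_funX.
have msq := @measurable_sq R s.
apply: (@le_lt_trans _ _ (\int[@leb2 R]_(z in sq s) (A'%:E * (w0 z + \sum_(j < M) w j z)))%E).
  apply: ge0_le_integral => //.
  - by move=> z _; rewrite lee_fin powR_ge0.
  - by apply: measurable_funeM; exact: emeasurable_funD.
rewrite ge0_integralZl_EFin//; last 3 first.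
- by move=> z _; rewrite adde_ge0.
- exact: emeasurable_funD.
- exact: ltW.
apply: lte_mul_pinfty; rewrite ?lee_fin ?(ltW A'0)//.
rewrite ge0_integralD// lte_add_pinfty//.
  by apply: weight2_integral => //; rewrite ?invr_ge0//; lra.
rewrite ge0_integral_sum// lte_sum_pinfty// => j _.
exact: weight2_integral.
Qed.

End LpBound.

(** * From the essential bound to a pointwise bound, and the conclusion *)

Section Main.
Context {R : realType}.
Local Notation "x %:C" := (real_complex R x).

(** With the denominator cleared, |Q| - |B| |P| is Lipschitz up to the origin, which the quotient
    need not be; the almost everywhere bound thus holds at every point with x nonzero. *)
Lemma Linfty_loc_bound (P Q : R[i] -> R[i] -> R[i]) (s0 : R) :
  analytic2_at0 P -> analytic2_at0 Q -> 0 < s0 ->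
  (forall x y, x != 0 -> `|x| < s0 -> `|y| < s0 -> P x%:C y%:C != 0) ->
  Linfty_loc (fun z : R * R => Q z.1%:C z.2%:C / P z.1%:C z.2%:C) ->
  exists s B, [/\ 0 < s, s <= s0, 0 <= B & forall x y, x != 0 -> `|x| < s -> `|y| < s ->
    cabs (Q x%:C y%:C) <= B * cabs (P x%:C y%:C)].
Proof.
move=> /analytic2_ReIm[rP [aPr aPi]] /analytic2_ReIm[rQ [aQr aQi]] s00 Pn0.
move=> [r [r0 [_ [B hB]]]].
have rP0 : 0 < rP by case: aPr => c [? []].
have rQ0 : 0 < rQ by case: aQr => c [? []].
have [C1 C10 l1] := real_analytic2_lipschitz aPr.
have [C2 C20 l2] := real_analytic2_lipschitz aPi.
have [C3 C30 l3] := real_analytic2_lipschitz aQr.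
have [C4 C40 l4] := real_analytic2_lipschitz aQi.
pose s := Num.min (Num.min s0 r) (Num.min (rP / 16) (rQ / 16)).
have sp : 0 < s by rewrite !lt_min s00 r0 !divr_gt0.
have [ss0 sr sP sQ] : [/\ s <= s0, s <= r, s <= rP / 16 & s <= rQ / 16].
  by rewrite !ge_min !lexx !orbT.
exists s, `|B|; split => // x y x0 xs ys.
rewrite -subr_le0.
apply: (@ae_le0_lipschitz _ (fun x y => cabs (Q x%:C y%:C) - `|B| * cabs (P x%:C y%:C))
   s (C3 + C4 + `|B| * (C1 + C2))) => //.
- by rewrite !addr_ge0// mulr_ge0// addr_ge0.
- move=> a b a' b' ha hb ha' hb'.
  have toP (t : R) : `|t| < s -> `|t| < rP / 16 by move=> /lt_le_trans; apply.
  have toQ (t : R) : `|t| < s -> `|t| < rQ / 16 by move=> /lt_le_trans; apply.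
  have e1 := l1 a b a' b' (toP _ ha) (toP _ hb) (toP _ ha') (toP _ hb').
  have e2 := l2 a b a' b' (toP _ ha) (toP _ hb) (toP _ ha') (toP _ hb').
  have e3 := l3 a b a' b' (toQ _ ha) (toQ _ hb) (toQ _ ha') (toQ _ hb').
  have e4 := l4 a b a' b' (toQ _ ha) (toQ _ hb) (toQ _ ha') (toQ _ hb').
  set T := `|a' - a| + `|b' - b| in e1 e2 e3 e4 *.
  have -> : cabs (Q a'%:C b'%:C) - `|B| * cabs (P a'%:C b'%:C)
     - (cabs (Q a%:C b%:C) - `|B| * cabs (P a%:C b%:C)) =
     (cabs (Q a'%:C b'%:C) - cabs (Q a%:C b%:C)) -
     `|B| * (cabs (P a'%:C b'%:C) - cabs (P a%:C b%:C)) by ring.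
  rewrite mulrDl; apply: le_trans (ler_normB _ _) _; apply: lerD.
    by apply: le_trans (cabs_dist_le _ _) _; rewrite mulrDl; exact: lerD.
  rewrite normrM normr_id -mulrA ler_wpM2l// mulrDl.
  by apply: le_trans (cabs_dist_le _ _) _; exact: lerD.
- case: hB => N [mN N0 hN]; exists N; split => // -[a b] hab; apply: hN => h.
  apply: hab => /= -[/=]; rewrite !in_itv/= -!ltr_norml => ha hb a0.
  have P0 : P a%:C b%:C != 0.
    by apply: Pn0 => //; apply: lt_le_trans ss0.
  have {}h : cabs (Q a%:C b%:C / P a%:C b%:C) <= B.
    by apply: h; split => /=; rewrite in_itv/= -ltr_norml; apply: lt_le_trans sr.
  rewrite subr_le0 -ler_pdivrMr ?cabs_gt0// -cabsV -cabsM.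
  by apply: le_trans h (ler_norm _).
Qed.

End Main.

(** The bound on p is 1 + 1/K with the denominator cleared, so that K = 0 admits every p. *)
Theorem theorem6p3 (R : realType) (P Q : R[i] -> R[i] -> R[i])
  (M k : nat) (u : R[i] -> R[i] -> R[i]) (rho : R[i] -> R[i])
  (L : 'I_M -> nat) (q : 'I_M -> {poly R}) (psi : 'I_M -> R[i] -> R[i]) :
  (* P in C{x,y}, P(0,y) not identically 0 *)
  analytic2_at0 P ->
  ~ (exists r : R, 0 < r /\ forall y : R[i], cabs y < r -> P 0 y = 0) ->
  (* no zeros in U cap (R x H) *)
  (exists r : R, 0 < r /\ forall (x : R) (y : R[i]),
      `|x| < r -> cabs y < r -> 0 < complex.Im y -> P (real_complex R x) y != 0) ->
  (* no factors in common with \bar P *)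
  no_common_factor P (pbar P) ->
  (* the local factorization P = u prod_j (y + q_j(x) + x^(2L_j) psi_j(x^(1/k))) *)
  ord0y P M ->
  analytic2_at0 u -> u 0 0 != 0 ->
  (1 <= k)%N ->
  (forall z : R[i], rho z ^+ k = z) ->
  (forall j, (q j).[0] = 0 /\ (size (q j) <= 2 * L j)%N) ->
  (forall j, analytic1_at0 (psi j) /\ 0 < complex.Im (psi j 0)) ->
  (exists r : R, 0 < r /\ forall x y : R[i], cabs x < r -> cabs y < r ->
      P x y = u x y * \prod_(j < M)
        (y + (map_poly (real_complex R) (q j)).[x] + x ^+ (2 * L j) * psi j (rho x))) ->
  (* Q in C{x,y} and Q/P in L^oo_loc *)
  analytic2_at0 Q ->
  Linfty_loc (fun z : R * R => Q (real_complex R z.1) (real_complex R z.2) / P (real_complex R z.1) (real_complex R z.2)) ->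
  let K := (\max_(j < M) (2 * L j))%N in
  forall p : R, 1 <= p -> p * K%:R < K%:R + 1 ->
  (* d/dy (Q/P) in L^p_loc *)
  exists g : R * R -> R[i], Lp_loc p g /\
    exists r : R, 0 < r /\ forall x y : R, `|x| < r -> `|y| < r ->
      P (real_complex R x) (real_complex R y) != 0 ->
      is_derive y 1 (fun t : R => complex.Re (Q (real_complex R x) (real_complex R t) / P (real_complex R x) (real_complex R t)))
                (complex.Re (g (x, y))) /\
      is_derive y 1 (fun t : R => complex.Im (Q (real_complex R x) (real_complex R t) / P (real_complex R x) (real_complex R t)))
                (complex.Im (g (x, y))).
Proof.
move=> aP _ _ _ _ au u0 k1 hrho _ hpsi hP aQ hQ K p p1 pK.
have [s1 [kap [C [s10 kap0 C0 dbl]]]] := product_doubling au u0 k1 hrho hpsi hP.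
have Pn0 x y : x != 0 -> `|x| < s1 -> `|y| < s1 ->
    P (real_complex R x) (real_complex R y) != 0.
  by move=> x0 xs ys; have [] := dbl x y x0 xs ys.
have [s [B [s0 ss1 B0 QP]]] := Linfty_loc_bound aP aQ s10 Pn0 hQ.
have dbl' : doubling (fun x y => P (real_complex R x) (real_complex R y))
      (fun j x y => kap * (`|y + (q j).[x]| + `|x| ^+ (2 * L j))) s C.
  move=> x y x0 xs ys.
  have [P0 h] := dbl x y x0 (lt_le_trans xs ss1) (lt_le_trans ys ss1).
  split => // d d0 /(h d d0)[h1 h2]; split => // t ts.
  exact: h2 (lt_le_trans ts ss1).
have [g [s' [A [s'0 A0 mg dg bg]]]] :=
  quotient_derivative s0 kap0 C0 B0 aP aQ dbl' QP.
exists g; split; last by exists s'.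
exact: Lp_loc_of_bound p1 pK s'0 A0 mg bg.
Qed.
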